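(* Let $p$ be a prime and let $G$ be a finite $p$-group with $D_3(G)=1$. Let $m$ be a positive integer such that $\gcd(m,c_G!)=1$. Then, for every finite $p$-group $H$, $$\mathbb F_{p^m}G\cong\mathbb F_{p^m}H\ \text{ (as } \mathbb F_{p^m}\text{-algebras) implies } G\cong H.$$
   Context: $\mathbb F G$ denotes the group algebra of $G$ over a field $\mathbb F$. All algebras are associative and unital, and algebra homomorphisms preserve the identity. $I_G=\{\sum_{g\in G}a_g g\in\mathbb F_pG:\sum_{g\in G}a_g=0\}$ is the augmentation ideal of $\mathbb F_pG$, and the third dimension subgroup is $D_3(G)=\{g\in G: g-1\in I_G^3\}$. $c_G$ is the number of geometric connected components of the automorphism algebraic group of $\mathbb F_pG$: let $\overline{\mathbb F}_p$ be an algebraic closure of $\mathbb F_p$. In terms of a basis, the group $\mathrm{Aut}_{\overline{\mathbb F}_p\text{-alg}}(\overline{\mathbb F}_pG)$ of $\overline{\mathbb F}_p$-algebra automorphisms of $\overline{\mathbb F}_pG$ is the set of invertible matrices over $\overline{\mathbb F}_p$ satisfying the polynomial equations expressing preservation of multiplication and identity, so it is an affine algebraic group; $c_G$ is its (finite) number of connected components in the Zariski topology. *)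

(* Defs.v *)
From HB Require Import structures.
From mathcomp Require Import all_boot all_order all_algebra.
From mathcomp Require Import all_fingroup all_solvable all_field.
From mathcomp Require Import finmap boolp classical_sets functions cardinality topology.
(* The notations of mpoly clash with those of MathComp-Analysis. *)
From mathcomp Require mpoly.
Import -(notations) mpoly.

Set Implicit Arguments.
Unset Strict Implicit.
Unset Printing Implicit Defensive.

Import GroupScope GRing.Theory.
Local Open Scope classical_set_scope.
Local Open Scope ring_scope.

(* An element [a] of the group algebra is its coefficient function: it stands  *)
(* for \sum_g a_g g.  It is wrapped in a record because {ffun gT -> F} already *)
(* carries the pointwise product.                                              *)
Record galg (F : fieldType) (gT : finGroupType) :=
  GAlg { gcoef : {ffun gT -> F} }.

Arguments gcoef : simpl never.

Section GroupAlgebra.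

Variables (F : fieldType) (gT : finGroupType).
Local Notation A := (galg F gT).
Implicit Types (a b c : A) (g h : gT).

HB.instance Definition _ := [isNew for @gcoef F gT].
HB.instance Definition _ := [Choice of A by <:].

Definition galg_zero : A := GAlg 0.
Definition galg_opp a : A := GAlg (- gcoef a).
Definition galg_add a b : A := GAlg (gcoef a + gcoef b).
Definition galg_scale (k : F) a : A := GAlg [ffun g => k * gcoef a g].

Lemma gcoef_inj : injective (@gcoef F gT). Proof. exact: val_inj. Qed.

Lemma galgP a b : (forall g, gcoef a g = gcoef b g) <-> a = b.
Proof. by split=> [ab|->//]; apply/gcoef_inj/ffunP. Qed.

Fact galg_addA : associative galg_add.
Proof. by move=> a b c; apply/galgP=> g; rewrite !ffunE addrA. Qed.
Fact galg_addC : commutative galg_add.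
Proof. by move=> a b; apply/galgP=> g; rewrite !ffunE addrC. Qed.
Fact galg_add0 : left_id galg_zero galg_add.
Proof. by move=> a; apply/galgP=> g; rewrite !ffunE add0r. Qed.
Fact galg_addN : left_inverse galg_zero galg_opp galg_add.
Proof. by move=> a; apply/galgP=> g; rewrite !ffunE addNr. Qed.

HB.instance Definition _ :=
  GRing.isZmodule.Build A galg_addA galg_addC galg_add0 galg_addN.

Lemma gcoef0 g : gcoef (0 : A) g = 0. Proof. by rewrite ffunE. Qed.
Lemma gcoefN a g : gcoef (- a) g = - gcoef a g. Proof. by rewrite ffunE. Qed.
Lemma gcoefD a b g : gcoef (a + b) g = gcoef a g + gcoef b g.
Proof. by rewrite ffunE. Qed.

Fact galg_scaleA k l a :
  galg_scale k (galg_scale l a) = galg_scale (k * l) a.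
Proof. by apply/galgP=> g; rewrite !ffunE mulrA. Qed.
Fact galg_scale1 : left_id 1 galg_scale.
Proof. by move=> a; apply/galgP=> g; rewrite !ffunE mul1r. Qed.
Fact galg_scaleDr : right_distributive galg_scale +%R.
Proof. by move=> k a b; apply/galgP=> g; rewrite !ffunE mulrDr. Qed.
Fact galg_scaleDl a : {morph galg_scale^~ a : k l / k + l}.
Proof. by move=> k l; apply/galgP=> g; rewrite !ffunE mulrDl. Qed.

HB.instance Definition _ := GRing.Zmodule_isLmodule.Build F A
  galg_scaleA galg_scale1 galg_scaleDr galg_scaleDl.

Lemma gcoefZ k a g : gcoef (k *: a) g = k * gcoef a g.
Proof. by rewrite ffunE. Qed.

Lemma gcoef_sum (I : Type) (r : seq I) (P : pred I) (E : I -> A) g :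
  gcoef (\sum_(i <- r | P i) E i) g = \sum_(i <- r | P i) gcoef (E i) g.
Proof.
by elim/big_rec2: _ => [|i x y _ <-]; rewrite ?gcoef0 // gcoefD.
Qed.

Definition gelt g : A := GAlg [ffun h => (h == g)%:R].

Definition galg_one : A := gelt 1%g.
Definition galg_mul a b : A :=
  GAlg [ffun h => \sum_(g : gT) gcoef a g * gcoef b (g^-1 * h)%g].

Fact galg_mulA : associative galg_mul.
Proof.
move=> a b c; apply/galgP=> h; rewrite !ffunE.
under eq_bigr do rewrite ffunE mulr_sumr.
under [RHS]eq_bigr do rewrite ffunE mulr_suml.
rewrite [RHS]exchange_big /=; apply: eq_bigr => g _.
rewrite [RHS](reindex_inj (mulgI g)) /=; apply: eq_bigr => k _.
by rewrite mulKg invMg !mulgA mulrA.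
Qed.
Fact galg_mul1l : left_id galg_one galg_mul.
Proof.
move=> a; apply/galgP=> h; rewrite ffunE (bigD1 1%g) //= ffunE eqxx mul1r.
rewrite invg1 mul1g big1 ?addr0 // => g /negPf g1.
by rewrite ffunE g1 mul0r.
Qed.
Fact galg_mul1r : right_id galg_one galg_mul.
Proof.
move=> a; apply/galgP=> h; rewrite ffunE (bigD1 h) //= ffunE mulVg eqxx mulr1.
rewrite big1 ?addr0 // => g /negPf gh.
by rewrite ffunE -eq_mulVg1 gh mulr0.
Qed.
Fact galg_mulDl : left_distributive galg_mul +%R.
Proof.
move=> a b c; apply/galgP=> h; rewrite !ffunE -big_split /=.
by apply: eq_bigr => g _; rewrite gcoefD mulrDl.
Qed.
Fact galg_mulDr : right_distributive galg_mul +%R.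
Proof.
move=> a b c; apply/galgP=> h; rewrite !ffunE -big_split /=.
by apply: eq_bigr => g _; rewrite gcoefD mulrDr.
Qed.
Fact galg_one_neq0 : galg_one != 0.
Proof.
by apply/eqP=> /galgP/(_ 1%g)/eqP; rewrite gcoef0 ffunE eqxx oner_eq0.
Qed.

HB.instance Definition _ := GRing.Zmodule_isNzRing.Build A
  galg_mulA galg_mul1l galg_mul1r galg_mulDl galg_mulDr galg_one_neq0.

Lemma gcoefM a b h :
  gcoef (a * b) h = \sum_(g : gT) gcoef a g * gcoef b (g^-1 * h)%g.
Proof. by rewrite ffunE. Qed.

Fact galg_scaleAl (k : F) a b : k *: (a * b) = (k *: a) * b.
Proof.
apply/galgP=> h; rewrite gcoefZ !gcoefM mulr_sumr.
by apply: eq_bigr => g _; rewrite gcoefZ mulrA.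
Qed.
HB.instance Definition _ := GRing.Lmodule_isLalgebra.Build F A galg_scaleAl.

Fact galg_scaleAr (k : F) a b : k *: (a * b) = a * (k *: b).
Proof.
apply/galgP=> h; rewrite gcoefZ !gcoefM mulr_sumr.
by apply: eq_bigr => g _; rewrite gcoefZ mulrCA.
Qed.
HB.instance Definition _ := GRing.Lalgebra_isAlgebra.Build F A galg_scaleAr.

Fact galg_vect_axiom : Vector.axiom #|gT| A.
Proof.
exists (fun a => \row_i gcoef a (enum_val i)) => [k a b|].
  by apply/rowP=> i; rewrite !mxE gcoefD gcoefZ.
exists (fun v : 'rV_#|gT| => GAlg [ffun g => v 0 (enum_rank g)]) => [a|v].
  by apply/galgP=> g; rewrite ffunE mxE enum_rankK.
by apply/rowP=> i; rewrite mxE ffunE enum_valK.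
Qed.
HB.instance Definition _ := Lmodule_hasFinDim.Build F A galg_vect_axiom.
HB.instance Definition _ := Algebra_isFalgebra.Build F A.

Lemma galg_sum_gelt a : a = \sum_(g : gT) gcoef a g *: gelt g.
Proof.
apply/galgP=> h; rewrite gcoef_sum (bigD1 h isT) gcoefZ ffunE eqxx mulr1.
rewrite big1 => [|g /negPf gh]; first by rewrite [RHS]addr0.
by rewrite gcoefZ ffunE eq_sym gh mulr0.
Qed.

Lemma gelt1 : gelt 1%g = 1. Proof. by []. Qed.
Lemma geltM g h : gelt (g * h)%g = gelt g * gelt h.
Proof.
apply/galgP=> k; rewrite gcoefM (bigD1 g) //= !ffunE eqxx mul1r.
rewrite big1 ?addr0 => [|l /negPf lg]; last by rewrite ffunE lg mul0r.
by rewrite -(inj_eq (mulgI g^-1%g)) mulKg.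
Qed.

Definition augmentation a : F^o := \sum_(g : gT) gcoef a g.

Fact augmentation_is_linear : linear augmentation.
Proof.
move=> k a b; rewrite /augmentation scaler_sumr -big_split /=.
by apply: eq_bigr => g _; rewrite gcoefD gcoefZ.
Qed.
HB.instance Definition _ := GRing.isLinear.Build F A F^o _ augmentation
  augmentation_is_linear.

Definition aug_ideal : {vspace A} := lker (linfun augmentation).

Lemma mem_aug_ideal a : (a \in aug_ideal) = (\sum_(g : gT) gcoef a g == 0).
Proof. by rewrite memv_ker lfunE. Qed.

(* [(U ^+ n)%VS] is the span of all n-fold products of elements of [U], so for *)
(* n > 0 this is the n-th power of the ideal; only such n are meaningful.      *)
Definition dimension_subgroup n : {set gT} :=
  [set g | gelt g - 1 \in (aug_ideal ^+ n)%VS]%SET.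

End GroupAlgebra.

(* An alias, so that 'rV[K]_n itself does not receive the Zariski topology. *)
Definition affine_space (K : fieldType) (n : nat) := 'rV[K]_n.

Section Zariski.

Variables (K : fieldType) (n : nat).
Local Notation V := (affine_space K n).

HB.instance Definition _ := Choice.on V.

Definition zero_locus (S : set (mpoly n K)) : set V :=
  [set x | forall f, S f -> meval (x 0) f = 0].

Definition zariski_open (U : set V) := exists S, ~` U = zero_locus S.

Fact zariski_openT : zariski_open setT.
Proof.
exists [set 1]; rewrite setCT; apply/seteqP; split=> // x /(_ 1 erefl)/eqP.
by rewrite meval1 oner_eq0.
Qed.

Fact zariski_openI : setI_closed zariski_open.
Proof.
move=> U1 U2 [S1 US1] [S2 US2].
exists [set f | exists f1 f2, [/\ S1 f1, S2 f2 & f = f1 * f2]].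
rewrite setCI US1 US2; apply/seteqP; split=> x /=.
  case=> x0 _ [f1 [f2 [Sf1 Sf2 ->]]]; rewrite mevalM.
    by rewrite (x0 _ Sf1) mul0r.
  by rewrite (x0 _ Sf2) mulr0.
move=> x0; apply/or_asboolP/negPn; rewrite negb_or.
apply/andP=> -[/asboolPn/existsNP[f1 /not_implyP[Sf1 /eqP f1x]]].
move=> /asboolPn/existsNP[f2 /not_implyP[Sf2 /eqP f2x]].
have /eqP := x0 (f1 * f2) (ex_intro _ f1 (ex_intro _ f2 (And3 Sf1 Sf2 erefl))).
by rewrite mevalM mulf_eq0 (negPf f1x) (negPf f2x).
Qed.

Fact zariski_open_bigU (I : Type) (U : I -> set V) :
  (forall i, zariski_open (U i)) -> zariski_open (\bigcup_i U i).
Proof.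
move=> /choice[S US]; exists (\bigcup_i S i).
rewrite setC_bigcup; apply/seteqP; split=> [x Ux f [i _ Sif]|x x0 i _].
  by have := Ux i Logic.I; rewrite US; apply.
by rewrite US => f Sif; apply: x0; exists i.
Qed.

HB.instance Definition _ := isOpenTopological.Build V
  zariski_openT zariski_openI zariski_open_bigU.

Lemma zariski_closedP (Z : set V) :
  closed Z <-> exists S, Z = zero_locus S.
Proof. by rewrite -openC; split=> -[S ZS]; exists S; rewrite -?ZS ?setCK. Qed.

End Zariski.

Section AutomorphismGroup.

Variables (K : fieldType) (gT : finGroupType).
Local Notation n := #|gT|.

(* The linear endomorphism of the group algebra whose matrix in the basis of  *)
(* group elements, acting on the right on row vectors, is [M].                 *)
Definition galg_endo (M : 'M[K]_n) (a : galg K gT) : galg K gT :=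
  \sum_(i < n) \sum_(j < n)
    (gcoef a (enum_val i) * M i j) *: gelt K (enum_val j).

(* [vec_mx] identifies affine n^2-space with the space of n x n matrices. *)
Definition galg_aut : set (affine_space K (n * n)) :=
  [set v | vec_mx v \in unitmx /\ monoid_morphism (galg_endo (vec_mx v))].

Definition aut_components : set (set (affine_space K (n * n))) :=
  [set connected_component galg_aut v | v in galg_aut].

(* [fset_set] is empty on infinite sets; this default is not met here, since a *)
(* Zariski topology is Noetherian and so has finitely many components.         *)
Definition num_aut_components : nat := #|` fset_set aut_components|.

End AutomorphismGroup.

(* Main.v *)
Require Import Defs.
From HB Require Import structures.
From mathcomp Require Import all_boot all_order all_algebra.
From mathcomp Require Import all_fingroup all_solvable all_field.
From mathcomp Require Import finmap boolp classical_sets cardinality topology.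
From mathcomp Require mpoly.
Import -(notations) mpoly.

Set Implicit Arguments.
Unset Strict Implicit.
Unset Printing Implicit Defensive.

Import GRing.Theory.
Local Open Scope ring_scope.
Local Open Scope classical_set_scope.

(** Write I for the augmentation ideal, K for an algebraic closure of F_p and s
    for the Frobenius map on coordinates.  The proof first replaces F_{p^m} by
    F_p, and then recovers G from F_pG.

    Descent.  An isomorphism P : F_{p^m}G -> F_{p^m}H, extended to K, gives a
    point a = P s(P)^-1 of the automorphism group Aut(KG) whose twisted powers
    a s(a) s^2(a) ... telescope, the product of the first m being 1.  It suffices
    to write a = b^-1 s(b) with b in Aut(KG), because bP is then fixed by s, hence
    an isomorphism F_pG -> F_pH ([descent], [group_algebra_descent]).

    The maps v |-> a s(v) and v |-> s(v) permute the components of Aut(KG), and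
    have the same m-th power.  Permutations of c_G letters have order dividing
    c_G!, which is prime to m, so both induce the same permutation
    ([component_map_coprime]).  Looking at the component of 1, a lies in it.
    That c_G is a genuine count, and not the default value of the cardinal of an
    infinite set, is the Noetherian property of the Zariski topology
    ([closed_dcc], [finite_components]).

    Points a in the component of 1 have the form b^-1 s(b): this is Lang's
    theorem ([lang_taut]).  It is proved here without dimension theory.  To each
    a attach the F_p-algebra of vectors fixed by v |-> s(v) a^-1.  Lang's theorem
    for GL_n ([lang_GL]) gives a K-basis of fixed vectors, and its structure
    constants lie in F_p; so finitely many algebras occur.  Those a for which a
    given algebra occurs form a closed set, namely the image of a closed set under
    the projection (a, y) |-> a from the variety s(y) = ya, which is finite over
    the a-space ([closed_elimination]).  Finitely many disjoint closed sets are
    open in their union, so all points of one component get the same algebra.  If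
    a gets the same algebra as 1, comparing the two bases of fixed vectors gives
    the required b.

    Over F_p.  Modulo I^3 the group of units 1 + I has the central elementary
    abelian subgroup 1 + I^2, and it is the product of G and 1 + I^2, meeting in
    the image of the Frattini subgroup Phi(G), since g - 1 lies in I^2 exactly for
    g in Phi(G) ([D2_Phi], [Phi_pow2]).  Choose a complement Y of that image in
    I^2 modulo I^3 ([coset_space]).  As D_3(G) = 1, each unit in 1 + I is congruent
    modulo Y to exactly one element of G ([coset_repr], [coset_repr_uniq]).
    Transporting H into 1 + I and rounding gives a homomorphism H -> G.  It is onto
    because an isomorphism of group algebras carries the Frattini part to the
    Frattini part: modulo I^3, commutators and p-th powers of units u, v are
    expressed by the brackets and p-th powers of u - 1 and v - 1
    ([Phi_frattini_mod]).  As G and H have the same order, they are isomorphic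
    ([D3_isog]). *)

(** * Regular functions and the Zariski topology *)

Section Regular.
Variables (K : fieldType) (r : nat).
Local Notation X := (affine_space K r).
Implicit Types f g : X -> K.

Definition regular f := exists P : mpoly r K, forall x, f x = meval (x 0) P.

Lemma regular_ext f g : f =1 g -> regular f -> regular g.
Proof. by move=> fg [P fP]; exists P => x; rewrite -fg. Qed.

Lemma regular_cst c : regular (fun=> c).
Proof. by exists (mpolyC r c) => x; rewrite mevalC. Qed.

Lemma regular_coord i : regular (fun x => x 0 i).
Proof. by exists (mpolyX K (mnm1 i)) => x; rewrite mevalXU. Qed.

Lemma regularD f g : regular f -> regular g -> regular (fun x => f x + g x).
Proof. by move=> [P fP] [Q gQ]; exists (P + Q) => x; rewrite mevalD fP gQ. Qed.

Lemma regularM f g : regular f -> regular g -> regular (fun x => f x * g x).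
Proof. by move=> [P fP] [Q gQ]; exists (P * Q) => x; rewrite mevalM fP gQ. Qed.

Lemma regular_sum (I : Type) (s : seq I) (F : I -> X -> K) :
  (forall i, regular (F i)) -> regular (fun x => \sum_(i <- s) F i x).
Proof.
move=> rF; elim: s => [|i s IHs].
  by apply: regular_ext (regular_cst 0) => x; rewrite big_nil.
by apply: regular_ext (regularD (rF i) IHs) => x; rewrite big_cons.
Qed.

Lemma regular_prod (I : Type) (s : seq I) (F : I -> X -> K) :
  (forall i, regular (F i)) -> regular (fun x => \prod_(i <- s) F i x).
Proof.
move=> rF; elim: s => [|i s IHs].
  by apply: regular_ext (regular_cst 1) => x; rewrite big_nil.
by apply: regular_ext (regularM (rF i) IHs) => x; rewrite big_cons.
Qed.

Lemma regularX f k : regular f -> regular (fun x => f x ^+ k).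
Proof.
move=> rf; elim: k => [|k IHk]; first exact: regular_cst.
by apply: regular_ext (regularM rf IHk) => x; rewrite exprS.
Qed.

Lemma regular_det k (M : X -> 'M[K]_k) :
  (forall i j, regular (fun x => M x i j)) -> regular (fun x => \det (M x)).
Proof.
by move=> rM; apply: regular_sum => s; apply: regularM (regular_cst _) _;
  apply: regular_prod.
Qed.

Lemma closed_regular (I : Type) (f : I -> X -> K) :
  (forall i, regular (f i)) -> closed [set x | forall i, f i x = 0].
Proof.
move=> /choice[P fP]; apply/zariski_closedP; exists (range P).
apply/seteqP; split=> x /= x0 => [_ [i _ <-]|i]; first by rewrite -fP.
by rewrite fP; apply: x0; exists i.
Qed.

End Regular.

(** A map whose coordinates are regular is continuous: it pulls polynomials
    back to polynomials. *)
Lemma regular_continuous (K : fieldType) (r s : nat)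
    (phi : affine_space K r -> affine_space K s) :
  (forall j, regular (fun x => phi x 0 j)) -> continuous phi.
Proof.
move=> rphi; apply/continuous_closedP => Z /zariski_closedP[S ->].
have -> : phi @^-1` zero_locus S =
    [set x | forall P : {P | S P}, meval (phi x 0) (sval P) = 0].
  apply/seteqP; split=> x /= x0; first by case=> P SP; apply: x0.
  by move=> P SP; apply: (x0 (exist _ P SP)).
apply: closed_regular => -[P _] /=.
apply: regular_ext (_ : regular (fun x =>
  \sum_(m <- msupp P) mcoeff m P * \prod_i phi x 0 i ^+ m i)).
  by move=> x; rewrite mevalE.
apply: regular_sum => m; apply: regularM; first exact: regular_cst.
by apply: regular_prod => i; apply: regularX.
Qed.

(** * Finiteness of the set of components *)

Section Dickson.

Lemma nondecreasing_subsequence (v : nat -> nat) :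
  exists2 phi : nat -> nat, {homo phi : i j / (i < j)%N} &
    {homo v \o phi : i j / (i <= j)%N}.
Proof.
have /choice[next nextP] N :
    exists i, (N <= i)%N /\ forall j, (N <= j)%N -> (v i <= v j)%N.
  pose P a := `[< exists2 i, (N <= i)%N & v i = a >].
  have exP : exists a, P a by exists (v N); apply/asboolP; exists N.
  have [a /asboolP[i Ni va] a_min] := ex_minnP exP.
  exists i; split=> // j Nj; rewrite va; apply: a_min.
  by apply/asboolP; exists j.
(* next N is a place where v is minimal on [N, oo). *)
pose phi := fix phi k := if k is k'.+1 then next (phi k').+1 else next 0%N.
have phi_step k : (phi k < phi k.+1)%N by have [] := nextP (phi k).+1.
exists phi; first exact: homo_ltn ltn_trans phi_step.
apply: homo_leq => [//||k]; first exact: leq_trans.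
have phiE : phi k = next (if k is k'.+1 then (phi k').+1 else 0%N) by case: k.
have [] := nextP (if k is k'.+1 then (phi k').+1 else 0%N); rewrite -phiE => le_k.
by apply; apply: leq_trans le_k (ltnW (phi_step k)).
Qed.

(** Dickson's lemma: refine a sequence once for each coordinate, so that all of
    them become nondecreasing. *)
Lemma dickson (I : finType) (u : nat -> I -> nat) :
  exists i j, (i < j)%N /\ forall k, (u i k <= u j k)%N.
Proof.
suff [phi phi_inc u_inc] : exists2 phi : nat -> nat,
    {homo phi : i j / (i < j)%N} &
    forall k, k \in enum I -> {homo (fun i => u (phi i) k) : i j / (i <= j)%N}.
  exists (phi 0%N), (phi 1%N); split=> [|k]; first exact: phi_inc.
  by apply: u_inc => //; rewrite mem_enum.
elim: (enum I) => [|k s [phi phi_inc u_inc]]; first by exists id.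
have [psi psi_inc v_inc] := nondecreasing_subsequence (fun i => u (phi i) k).
exists (phi \o psi) => [i j ij|l]; first exact/phi_inc/psi_inc.
rewrite inE => /orP[/eqP->|ls] i j ij; first exact: v_inc.
by apply: u_inc => //; move: ij; rewrite leq_eqVlt => /orP[/eqP->//|/psi_inc/ltnW].
Qed.

End Dickson.

Section Noetherian.
Variables (K : fieldType) (r : nat).
Local Notation X := (affine_space K r).
Implicit Types (Z : set X) (P Q : mpoly r K).

Definition vanishing Z : set (mpoly r K) :=
  [set P | forall x, Z x -> meval (x 0) P = 0].

Definition leading Z : set (multinom r) :=
  [set m | exists P, [/\ vanishing Z P, P != 0 & mlead P = m]].

Lemma vanishingS Z Z' : Z' `<=` Z -> vanishing Z `<=` vanishing Z'.
Proof. by move=> ZZ P ZP x /ZZ/ZP. Qed.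

Lemma leadingS Z Z' : Z' `<=` Z -> leading Z `<=` leading Z'.
Proof. by move=> /vanishingS ZZ m [P [/ZZ]]; exists P. Qed.

Lemma leading_up Z (m m' : multinom r) :
  leading Z m -> (forall i, m i <= m' i)%N -> leading Z m'.
Proof.
move=> [P [ZP P0 <-]] mm'; pose d := mnm_sub m' (mlead P).
have X0 : mpolyX K d != 0.
  by apply/eqP => /(congr1 (mcoeff d))/eqP; rewrite mcoeffX eqxx mcoeff0 oner_eq0.
exists (mpolyX K d * P); split=> [x Zx||]; first by rewrite mevalM ZP ?mulr0.
  by rewrite mulf_neq0.
by rewrite mleadM // mleadXm submK //; apply/mnm_lepP.
Qed.

(** Division with respect to the monomial order: an ideal is determined by its
    leading monomials within any larger ideal. *)
Lemma vanishing_leading Z Z' : Z' `<=` Z ->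
  leading Z' `<=` leading Z -> vanishing Z' `<=` vanishing Z.
Proof.
move=> ZZ ldZ; elim/mleadrect => P IHP Z'P.
have [->|P0] := eqVneq P 0; first by move=> x _; rewrite meval0.
have [Q [ZQ Q0 PQ]] : leading Z (mlead P) by apply: ldZ; exists P.
set c := mcoeff (mlead P) P / mcoeff (mlead Q) Q.
have dE : P = (P - c *: Q) + c *: Q by rewrite subrK.
suff ZD : vanishing Z (P - c *: Q).
  by move=> x Zx; rewrite dE mevalD mevalZ ZD // ZQ // mulr0 addr0.
have [->|D0] := eqVneq (P - c *: Q) 0; first by move=> x _; rewrite meval0.
apply: IHP => [|x Z'x]; last first.
  by rewrite mevalB mevalZ Z'P // ZQ ?mulr0 ?subr0 //; apply: ZZ.
rewrite Order.POrderTheory.lt_neqAle; apply/andP; split.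
  apply: contra_neq D0 => DP; apply/eqP; rewrite -mleadc_eq0 DP.
  by rewrite mcoeffB mcoeffZ /c -PQ mulfVK ?subrr // mleadc_eq0.
apply: (Order.POrderTheory.le_trans (mleadB_le _ _)).
by rewrite Order.JoinTheory.leUx Order.POrderTheory.lexx /= -PQ mleadZ_le.
Qed.

(** Hilbert's basis theorem in geometric form.  At each strict step the ideal
    grows, hence so does its set of leading monomials; choose a new monomial m_k.
    Some m_i divides a later m_j, which was therefore not new. *)
Lemma closed_dcc (Z : nat -> set X) :
    (forall k, closed (Z k)) -> (forall k, Z k.+1 `<=` Z k) ->
  exists k, Z k.+1 = Z k.
Proof.
move=> clZ decZ; apply: contrapT => /forallNP neZ.
have /choice[m mP] k : exists m, leading (Z k.+1) m /\ ~ leading (Z k) m.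
  apply: contrapT => /forallNP noL; apply: (neZ k); apply/seteqP; split=> //.
  have /zariski_closedP[S ZS] := clZ k.+1.
  have /vanishing_leading VZ : leading (Z k.+1) `<=` leading (Z k).
    by move=> m' m'L; apply: contrapT => nL; apply: (noL m').
  move=> x Zx; rewrite ZS => P SP; apply: (VZ (decZ k) P) Zx => y.
  by rewrite ZS; apply.
have [i [j [ij le_mij]]] := dickson m.
have [Li _] := mP i; have [_ []] := mP j.
suff /leadingS : Z j `<=` Z i.+1 by apply; apply: leading_up Li le_mij.
elim: j ij {le_mij} => // j IHj; rewrite ltnS leq_eqVlt => /orP[/eqP->//|/IHj].
exact: subset_trans.
Qed.

(** Noetherian induction shows that A is a finite union of connected sets: a
    closed Z for which this fails for A & Z contains a strictly smaller one.  Each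
    component is then the component of one of these connected sets. *)
Lemma finite_components (A : set X) :
  finite_set [set connected_component A v | v in A].
Proof.
pose good (Z : set X) := exists s : seq (set X),
  (forall C, C \in s -> connected C) /\ A `&` Z = \bigcup_(C in [set` s]) C.
have shrink (Z : {Z : set X | closed Z /\ ~ good Z}) :
    exists Z' : {Z : set X | closed Z /\ ~ good Z},
    sval Z' `<=` sval Z /\ sval Z' != sval Z.
  case: Z => Z [clZ badZ] /=.
  have : ~ connected (A `&` Z).
    move=> cAZ; apply: badZ; exists [:: A `&` Z]; split=> [C|].
      by rewrite inE => /eqP->.
    apply/seteqP; split=> x; first by exists (A `&` Z); rewrite //= inE.
    by case=> C /=; rewrite inE => /eqP->.
  move=> /existsNP[B] /not_implyP[B0 /not_implyP[[O oO BO]]].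
  move=> /not_implyP[[C cC BC] /eqP neB].
  (* B is open and closed in A & Z; cut Z accordingly. *)
  pose Z1 := Z `&` C; pose Z2 := Z `&` ~` O.
  have clZ1 : closed Z1 by apply: closedI.
  have clZ2 : closed Z2 by apply: closedI => //; apply: open_closedC.
  have AZ1 : A `&` Z1 = B by rewrite setIA BC.
  have AZ2 : A `&` Z2 = (A `&` Z) `&` ~` B.
    rewrite BO setCI setIUr setICr set0U !setIA //.
  have [[s1 [s1c s1U]]|bad1] := pselect (good Z1); last first.
    exists (exist _ Z1 (conj clZ1 bad1)); split=> /=; first by move=> x [].
    by apply: contra_neq neB => ZZ; rewrite -AZ1 ZZ.
  have [[s2 [s2c s2U]]|bad2] := pselect (good Z2); last first.
    exists (exist _ Z2 (conj clZ2 bad2)); split=> /=; first by move=> x [].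
    have [x Bx] := B0; apply/eqP => ZZ.
    have AZx : (A `&` Z) x by move: Bx; rewrite BO => -[].
    by move: AZx; rewrite -ZZ AZ2 => -[].
  case: badZ; exists (s1 ++ s2); split=> [D|].
    by rewrite mem_cat => /orP[/s1c|/s2c].
  have -> : A `&` Z = (A `&` Z1) `|` (A `&` Z2).
    rewrite AZ1 AZ2 -{1}(setIT (A `&` Z)) -(setUCr B) setIUr; congr (_ `|` _).
    by apply/setIidPr; rewrite BO => x [].
  rewrite s1U s2U -bigcup_setU; congr bigcup.
  by apply/seteqP; split=> D /=; rewrite mem_cat => /orP.
have [goodT|badT] := pselect (good setT); last first.
  have [Zs [Zs0 ZsS]] := dependent_choice (fun W => cid (shrink W))
    (exist _ setT (conj closedT badT)).
  have [k] := closed_dcc (fun k => proj1 (svalP (Zs k))) (fun k => proj1 (ZsS k)).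
  by have [_ /eqP] := ZsS k.
have [s [sc]] := goodT; rewrite setIT => As.
pose pick C : set X := if pselect (exists v, C v) is left e
  then connected_component A (projT1 (cid e)) else set0.
apply: (@sub_finite_set _ _ (pick @` [set` s])); last first.
  exact/finite_image/finite_seq.
have Acov v : A v -> exists2 C, [set` s] C & C v by rewrite As.
move=> _ [v Av <-]; have [C sC Cv] := Acov v Av; exists C => //.
rewrite /pick; case: pselect => [e|[]]; last by exists v.
case: (cid e) => w Cw /=; apply: same_connected_component.
exists C => //; split=> //; last exact: sc.
by rewrite As => x Cx; exists C.
Qed.

End Noetherian.

(** * Elimination along a finite projection *)

(** Over a point x of the parameter space, the fibre is given by equations
    y_i^p = sum_j ell_ij(x) y_j.  They allow every polynomial in y to be reduced
    to exponents smaller than p, so the total space is finite over the parameter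
    space, with the reduced monomials as generators. *)
Section Elimination.

Variables (K : fieldType) (r : nat) (J : finType) (p : nat).
Hypothesis p_gt1 : (1 < p)%N.
Local Notation X := (affine_space K r).
Variable ell : J -> J -> X -> K.
Hypothesis ell_regular : forall i j, regular (ell i j).

Definition frobenius_fibre (x : X) (y : {ffun J -> K}) :=
  forall i, y i ^+ p = \sum_j ell i j x * y j.

(** Exponents of the reduced monomials. *)
Definition reduced := {ffun J -> 'I_p}.

Definition monomial (y : {ffun J -> K}) (b : J -> nat) := \prod_j y j ^+ b j.

Definition reducible (g : X -> {ffun J -> K} -> K) :=
  exists2 c : reduced -> X -> K, (forall b, regular (c b)) &
  forall x y, frobenius_fibre x y -> g x y = \sum_b c b x * monomial y (val \o b).

Lemma reducible_ext f g :
    (forall x y, frobenius_fibre x y -> f x y = g x y) ->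
  reducible f -> reducible g.
Proof. by move=> fg [c rc fc]; exists c => // x y xy; rewrite -fg ?fc. Qed.

Lemma reducible0 : reducible (fun _ _ => 0).
Proof.
exists (fun _ _ => 0) => [b|x y _]; first exact: regular_cst.
by rewrite big1 // => b _; rewrite mul0r.
Qed.

Lemma reducibleD f g :
  reducible f -> reducible g -> reducible (fun x y => f x y + g x y).
Proof.
move=> [c rc fc] [d rd gd]; exists (fun b x => c b x + d b x) => [b|x y xy].
  exact: regularD.
by rewrite fc // gd // -big_split; apply: eq_bigr => b _; rewrite mulrDl.
Qed.

Lemma reducibleZ h f :
  regular h -> reducible f -> reducible (fun x y => h x * f x y).
Proof.
move=> rh [c rc fc]; exists (fun b x => h x * c b x) => [b|x y xy].
  exact: regularM.
by rewrite fc // mulr_sumr; apply: eq_bigr => b _; rewrite mulrA.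
Qed.

Lemma reducible_sum (I : Type) (s : seq I) (F : I -> X -> {ffun J -> K} -> K) :
  (forall i, reducible (F i)) -> reducible (fun x y => \sum_(i <- s) F i x y).
Proof.
move=> rF; elim: s => [|i s IHs].
  by apply: reducible_ext reducible0 => x y _; rewrite big_nil.
by apply: reducible_ext (reducibleD (rF i) IHs) => x y _; rewrite big_cons.
Qed.

Lemma monomialD y (b d : J -> nat) :
  monomial y (fun j => b j + d j)%N = monomial y b * monomial y d.
Proof. by rewrite -big_split; apply: eq_bigr => j _; rewrite exprD. Qed.

Lemma monomial1 y j : monomial y (fun k => (k == j) : nat) = y j.
Proof.
rewrite /monomial (bigD1 j) //= eqxx big1 ?mulr1 // => k /negPf ->.
by rewrite expr0.
Qed.

(** Trading y_j^p for a combination of the y_k lowers the total degree, as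
    p > 1; so the rewriting terminates on reduced monomials. *)
Lemma reducible_monomial (b : J -> nat) : reducible (fun _ y => monomial y b).
Proof.
have [k] := ubnP (\sum_j b j); elim: k => // k IHk in b *; rewrite ltnS => bk.
have [/forallP b_lt|] := boolP [forall j, b j < p]%N.
  pose e : reduced := [ffun j => Ordinal (b_lt j)].
  exists (fun d _ => (d == e)%:R) => [d|x y _]; first exact: regular_cst.
  rewrite (bigD1 e) //= eqxx mul1r big1 ?addr0; last first.
    by move=> d /negPf ->; rewrite mul0r.
  by apply: eq_bigr => j _; rewrite /= ffunE.
rewrite negb_forall => /existsP[j]; rewrite -leqNgt => pbj.
(* y^b = y_j^p y^d *)
pose d i := (b i - (i == j) * p)%N.
have bE i : b i = (d i + (i == j) * p)%N.
  by rewrite /d subnK //; case: eqP => [->|]; rewrite ?mul1n.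
have red_i i : reducible (fun _ y => y i * monomial y d).
  apply: reducible_ext (IHk (fun l => (l == i) + d l)%N _) => [x y _|].
    by rewrite monomialD monomial1.
  apply: leq_trans bk; rewrite (eq_bigr _ (fun i _ => bE i)) !big_split /=.
  rewrite addnC ltn_add2l (bigD1 i) //= eqxx big1 => [|l /negPf -> //].
  by rewrite (bigD1 j) //= eqxx mul1n ltn_addr.
apply: reducible_ext (_ : reducible (fun x y =>
  \sum_i ell j i x * (y i * monomial y d))).
  move=> x y xy; rewrite [RHS](_ : _ = y j ^+ p * monomial y d).
    by rewrite xy mulr_suml; apply: eq_bigr => i _; rewrite mulrA.
  rewrite (_ : monomial y b = monomial y (fun i => (i == j) * p + d i)%N); last first.
    by apply: eq_bigr => i _; rewrite addnC -bE.
  rewrite monomialD; congr (_ * _).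
  rewrite -{1}[y j]monomial1 /monomial -prodrXl; apply: eq_bigr => i _.
  by rewrite -exprM.
by apply: reducible_sum => i; apply: reducibleZ.
Qed.

Lemma reducibleM f g :
  reducible f -> reducible g -> reducible (fun x y => f x y * g x y).
Proof.
move=> [c rc fc] [d rd gd].
apply: reducible_ext (_ : reducible (fun x y => \sum_b \sum_e
    (c b x * d e x) * monomial y (fun j => b j + e j)%N)).
  move=> x y xy; rewrite fc // gd // mulr_suml; apply: eq_bigr => b _.
  rewrite mulr_sumr; apply: eq_bigr => e _.
  by rewrite monomialD mulrACA.
apply: reducible_sum => b; apply: reducible_sum => e.
by apply: reducibleZ; [apply: regularM | apply: reducible_monomial].
Qed.

Lemma reducible_regular h : regular h -> reducible (fun x _ => h x).
Proof.
move=> rh; apply: reducible_ext (reducibleZ rh (reducible_monomial (fun=> 0%N))).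
by move=> x y _; rewrite /monomial big1 ?mulr1.
Qed.

Lemma reducible_var j : reducible (fun _ y => y j).
Proof.
apply: reducible_ext (reducible_monomial (fun k => (k == j) : nat)) => x y _.
exact: monomial1.
Qed.

Lemma reducible_prod (I : Type) (s : seq I) (F : I -> X -> {ffun J -> K} -> K) :
  (forall i, reducible (F i)) -> reducible (fun x y => \prod_(i <- s) F i x y).
Proof.
move=> rF; elim: s => [|i s IHs].
  by apply: reducible_ext (reducible_regular (regular_cst _ 1)) => x y _;
    rewrite big_nil.
by apply: reducible_ext (reducibleM (rF i) IHs) => x y _; rewrite big_cons.
Qed.

Lemma reducibleX f k : reducible f -> reducible (fun x y => f x y ^+ k).
Proof.
move=> rf; elim: k => [|k IHk]; first exact: reducible_regular (regular_cst _ _).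
by apply: reducible_ext (reducibleM rf IHk) => x y _; rewrite exprS.
Qed.

Lemma reducible_det k (M : X -> {ffun J -> K} -> 'M[K]_k) :
  (forall i j, reducible (fun x y => M x y i j)) ->
  reducible (fun x y => \det (M x y)).
Proof.
move=> rM; apply: reducible_sum => s; apply: reducibleM.
  exact: reducible_regular (regular_cst _ _).
exact: reducible_prod.
Qed.

(** Lagrange interpolation, followed by reduction. *)
Lemma lagrange x (I : finType) (y : I -> {ffun J -> K}) (k : I) :
    injective y -> (forall l, frobenius_fibre x (y l)) ->
  exists w : reduced -> K,
    forall l, \sum_b w b * monomial (y l) (val \o b) = (l == k)%:R.
Proof.
move=> y_inj y_sol.
have /choice[h hP] (l : I) : exists h : X -> {ffun J -> K} -> K,
    [/\ reducible h, h x (y k) = 1 & l != k -> h x (y l) = 0].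
  have [lk|lk] := eqVneq l k.
    by exists (fun _ _ => 1); split=> //; apply/reducible_regular/regular_cst.
  have [j /eqP yj] : exists j, y k j <> y l j.
    by apply/existsNP => yj; case/eqP: lk; apply/y_inj/ffunP => j.
  exists (fun _ z => (y k j - y l j)^-1 * (z j - y l j)); split=> [||_].
  - apply: reducibleZ; first exact: regular_cst.
    apply: reducibleD (reducible_var j) _.
    exact: reducible_regular (regular_cst _ _).
  - by rewrite mulVf // subr_eq0.
  - by rewrite subrr mulr0.
have [l|c _ gc] := @reducible_prod _ (enum I) h; first by have [] := hP l.
exists (fun b => c b x) => l; rewrite -gc // big_enum.
have [->|lk] := eqVneq l k; first by rewrite big1 // => i _; have [] := hP i.
by rewrite (bigD1 l) //=; have [_ _ ->] := hP l; rewrite ?mul0r.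
Qed.

(** Points over which a finite family of equations has a common solution are
    cut out by equations.  Multiplication by f_s acts on the reduced monomials
    through a matrix M_s(x) with regular entries.  A common zero in the fibre
    gives a common null vector of the M_s(x).  When the fibre has the full
    number of points, evaluation at them diagonalises all M_s(x), and if they
    have no common zero, some combination of the M_s(x) with constant matrix
    coefficients is invertible. *)
Lemma closed_elimination (A : set X) (S : finType)
    (f : S -> X -> {ffun J -> K} -> K) :
    (forall s, reducible (f s)) ->
    (forall x, A x -> exists2 y : reduced -> {ffun J -> K},
       injective y & forall b, frobenius_fibre x (y b)) ->
  exists2 Z : set X, closed Z &
    forall x, A x ->
      (Z x <-> exists2 y, frobenius_fibre x y & forall s, f s x y = 0).
Proof.
move=> rf A_sep; pose N := #|{: reduced}|.
pose mono (y : {ffun J -> K}) (b : 'I_N) : K := monomial y (val \o enum_val b).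
have monoE (c : reduced -> K) (y : {ffun J -> K}) :
    \sum_b c b * monomial y (val \o b) = \sum_i c (enum_val i) * mono y i.
  by rewrite (reindex _ (onW_bij _ (enum_val_bij reduced))).
have /choice[M MP] (s : S) : exists M : X -> 'M[K]_N,
    (forall i j, regular (fun x => M x i j)) /\ forall x y,
    frobenius_fibre x y -> forall i, \sum_j M x i j * mono y j = f s x y * mono y i.
  have /choice[c cP] (i : 'I_N) : exists c : reduced -> X -> K,
      (forall b, regular (c b)) /\ forall x y, frobenius_fibre x y ->
      f s x y * mono y i = \sum_b c b x * monomial y (val \o b).
    have [c rc fc] := reducibleM (rf s)
      (reducible_monomial (fun j => val (enum_val i j))).
    by exists c; split.
  exists (fun x => \matrix_(i, j) c i (enum_val j) x); split=> [i j|x y xy i].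
    apply: (@regular_ext _ _ (c i (enum_val j))); first by move=> x; rewrite mxE.
    by have [] := cP i.
  have [_ ->] // := cP i; rewrite (monoE (c i ^~ x)).
  by apply: eq_bigr => j _; rewrite mxE.
(* By actE below, the values of the reduced monomials at a point y of the fibre
   form an eigenvector of each M s x, with eigenvalue f s x y. *)
pose D (U : S -> 'M[K]_N) x := \det (\sum_s U s *m M s x).
exists [set x | forall U, D U x = 0] => [|x Ax].
  apply: closed_regular => U; apply: regular_det => i j.
  apply: (@regular_ext _ _ (fun x => \sum_s \sum_k U s i k * M s x k j)).
    by move=> x; rewrite summxE; apply: eq_bigr => s _; rewrite mxE.
  apply: regular_sum => s; apply: regular_sum => k.
  by apply: regularM; [apply: regular_cst|have [] := MP s].
have actE s y : frobenius_fibre x y ->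
    M s x *m (\col_i mono y i) = f s x y *: \col_i mono y i.
  move=> xy; apply/colP => i; rewrite !mxE; have [_ <- //] := MP s.
  by apply: eq_bigr => j _; rewrite mxE.
split=> [Dx|[y xy fy] U]; last first.
  apply/eqP; rewrite /D -det_tr; apply/det0P.
  (* The eigenvector is nonzero: its entry at the monomial 1 is 1. *)
  exists (\col_i mono y i)^T; last first.
    apply: trmx_inj; rewrite -trmx_mul trmxK trmx0 mulmx_suml big1 // => s _.
    by rewrite -mulmxA actE // fy scale0r mulmx0.
  have [b bP] : exists b : 'I_N, mono y b = 1.
    exists (enum_rank [ffun=> Ordinal (ltnW p_gt1)]); rewrite /mono enum_rankK.
    by rewrite /monomial big1 // => j _; rewrite /= ffunE expr0.
  apply/eqP => /matrixP/(_ 0 b)/eqP; rewrite !mxE bP; exact/negP/oner_neq0.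
have [y0 y0_inj y0_sol] := A_sep x Ax.
pose y (k : 'I_N) := y0 (enum_val k).
have y_inj : injective y by move=> k l /y0_inj/enum_val_inj.
pose E := \matrix_(i, k) mono (y k) i.
have E_unit : E \in unitmx.
  have /choice[w wP] k := @lagrange x 'I_N y k y_inj (fun l => y0_sol _).
  suff : (\matrix_(k, i) w k (enum_val i)) *m E = 1%:M by case/mulmx1_unit.
  apply/matrixP => k l; rewrite !mxE eq_sym -wP monoE.
  by apply: eq_bigr => i _; rewrite !mxE.
apply: contrapT => nf.
have /choice[s sP] (k : 'I_N) : exists s, f s x (y k) <> 0.
  by apply/existsNP => fs; apply: nf; exists (y k); first exact: y0_sol.
(* In the eigenbasis E, let U_t select the points y_k at which f_t does not
   vanish; each point is selected by one index t = s k only. *)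
pose U t := E *m diag_mx (\row_k (s k == t)%:R) *m invmx E.
suff /negP[] : D U x != 0 by rewrite Dx.
have ME t : M t x *m E = E *m diag_mx (\row_k f t x (y k)).
  apply/matrixP => i k; rewrite mul_mx_diag !mxE mulrC.
  have [_ <-] := MP t; last exact: y0_sol.
  by apply: eq_bigr => j _; rewrite mxE.
have -> : D U x = \det (E *m diag_mx (\row_k f (s k) x (y k)) *m invmx E).
  congr (\det _); rewrite (_ : diag_mx _ = \sum_t diag_mx (\row_k (s k == t)%:R)
    *m diag_mx (\row_k f t x (y k))).
    rewrite mulmx_sumr mulmx_suml; apply: eq_bigr => t _.
    rewrite /U -!mulmxA; congr (_ *m (_ *m _)).
    by rewrite -[LHS]mulmx1 -(mulmxV E_unit) -!mulmxA (mulmxA (M t x)) ME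
      !mulmxA mulVmx // mul1mx.
  apply/matrixP => k l; rewrite summxE mxE (bigD1 (s k)) //= big1 => [|t /negPf tk].
    by rewrite addr0 mul_diag_mx !mxE eqxx mul1r.
  by rewrite mul_diag_mx !mxE eq_sym tk mul0r.
rewrite !det_mulmx det_diag !mulf_neq0 //.
- by rewrite -unitfE -unitmxE.
- by apply/prodf_neq0 => k _; rewrite mxE; apply/eqP.
- by rewrite -unitfE -unitmxE unitmx_inv.
Qed.

End Elimination.

(** * Twisted Frobenius maps on K^n *)

Lemma pigeonhole_seq (T : eqType) (s : seq T) (u : nat -> T) :
  (forall i, u i \in s) -> exists i j, (i < j <= size s)%N /\ u i = u j.
Proof.
move=> us; apply: contrapT => nu.
have u_inj : {in iota 0 (size s).+1 &, injective u}.
  move=> i j; rewrite !mem_iota /= add0n !ltnS => si sj uij; apply/eqP.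
  case: ltngtP => // ij; case: nu; first by exists i, j; rewrite ij.
  by exists j, i; rewrite ij.
have := @uniq_leq_size _ (map u (iota 0 (size s).+1)) s.
rewrite map_inj_in_uniq // iota_uniq size_map size_iota ltnn => /(_ isT) h.
by have // : false by apply: h => x /mapP[i _ ->].
Qed.

Lemma periodic_of_finite (T : eqType) (s : seq T) (f : T -> T) x :
  injective f -> (forall i, iter i f x \in s) -> exists2 k, (0 < k)%N & iter k f x = x.
Proof.
move=> f_inj fs; have [i [j [/andP[ij _]]]] := pigeonhole_seq fs.
rewrite -(subnKC (ltnW ij)) iterD => fx.
exists (j - i)%N; first by rewrite subn_gt0.
move: (iter (j - i) f x) fx => y {ij}.
by elim: i => [|i IHi] //= /f_inj/IHi.
Qed.

Lemma iter_period (T : Type) (f : T -> T) x k m :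
  iter k f x = x -> iter (k * m) f x = x.
Proof. by move=> fx; elim: m => [|m IHm]; rewrite ?muln0 // mulnS iterD IHm. Qed.

Section Frobenius.

Variables (p : nat) (p_prime : prime p) (K : closedFieldType).
Variable (eta : {rmorphism 'F_p -> K}).

Fact pchar_eta : p \in [pchar K].
Proof. by rewrite (fmorph_pchar eta) pchar_Fp. Qed.

Definition frob : {rmorphism K -> K} := pFrobenius_aut pchar_eta.

Lemma frobE x : frob x = x ^+ p. Proof. by []. Qed.

Lemma frob_inj : injective frob. Proof. exact: fmorph_inj. Qed.

Lemma iter_frobE k x : iter k frob x = x ^+ (p ^ k).
Proof. by elim: k => [|k /= ->]; rewrite ?expr1 // frobE -exprM expnSr. Qed.

Lemma eta_fixed z : frob (eta z) = eta z.
Proof. by rewrite frobE -rmorphXn -{2}[z]expf_card card_Fp. Qed.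

Lemma frob_fixed x : frob x = x -> exists z, x = eta z.
Proof.
rewrite frobE => /eqP; rewrite -subr_eq0 => x0.
have : root (map_poly eta ('X^#|'F_p| - 'X)) x.
  by rewrite rmorphB /= map_polyXn map_polyX card_Fp // rootE !hornerE.
rewrite finField_genPoly rmorph_prod rootE horner_prod /= => /eqP/eqP.
rewrite prodf_seq_eq0 => /hasP[z _]; rewrite rmorphB /= map_polyX map_polyC !hornerE.
by rewrite subr_eq0; exists z; apply/eqP.
Qed.

(** The elements of the subfield of order p^k. *)
Lemma fixed_roots k : (0 < k)%N ->
  exists rs : seq K, [/\ uniq rs, size rs = (p ^ k)%N &
    forall x, (x \in rs) = (x ^+ (p ^ k) == x)].
Proof.
move=> k_gt0; have q_gt1 : (1 < p ^ k)%N by rewrite -(exp1n k) ltn_exp2r ?prime_gt1.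
pose q : {poly K} := 'X^(p ^ k) - 'X.
have szq : size q = (p ^ k).+1.
  by rewrite size_polyDl ?size_polyXn // size_polyN size_polyX ltnS.
have lq : lead_coef q = 1.
  by rewrite lead_coefDl ?lead_coefXn // size_polyN size_polyX size_polyXn ltnS.
have [rs qE] := closed_field_poly_normal q.
rewrite lq scale1r in qE.
have rs_size : size rs = (p ^ k)%N by apply/eqP; rewrite -eqSS -szq qE size_prod_XsubC.
exists rs; split=> // [|x]; last first.
  by rewrite -root_prod_XsubC -qE /root !hornerE subr_eq0.
rewrite -separable_prod_XsubC -qE unlock derivB derivXn derivX -scaler_nat natrX.
rewrite (pcharf0 pchar_eta) expr0n (gtn_eqF k_gt0) scale0r sub0r.
by rewrite -scaleN1r coprimepZr ?oppr_eq0 ?oner_eq0 // coprimep1.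
Qed.

Hypothesis K_algebraic : integralRange eta.

(** The Frobenius map permutes the finitely many roots of a polynomial over
    F_p. *)
Lemma frob_periodic x : exists2 k, (0 < k)%N & iter k frob x = x.
Proof.
have [q q_monic qx] := K_algebraic x.
have [rs qE] := closed_field_poly_normal (map_poly eta q).
apply: (@periodic_of_finite _ rs) => [|i]; first exact: frob_inj.
have lq : lead_coef (map_poly eta q) != 0.
  by rewrite lead_coef_eq0 map_poly_eq0 monic_neq0.
suff : root (map_poly eta q) (iter i frob x).
  by rewrite qE rootZ // root_prod_XsubC.
elim: i => //= i; rewrite -(fmorph_root frob) -map_poly_comp.
by rewrite (eq_map_poly (g := eta)) // => z; rewrite /= eta_fixed.
Qed.

Lemma frob_periodic_fin (I : finType) (x : I -> K) :
  exists2 k, (0 < k)%N & forall i, x i ^+ (p ^ k) = x i.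
Proof.
have /choice[k kP] i : exists k, (0 < k)%N /\ iter k frob (x i) = x i.
  by have [k] := frob_periodic (x i); exists k.
exists (\prod_i k i)%N => [|i].
  by rewrite prodn_gt0 // => i; have [] := kP i.
by rewrite -iter_frobE (bigD1 i) //= iter_period //; have [] := kP i.
Qed.

Lemma iter_map_mxE m n k (A : 'M[K]_(m, n)) i j :
  iter k (map_mx frob) A i j = A i j ^+ (p ^ k).
Proof. by rewrite -iter_frobE; elim: k => //= k IHk; rewrite mxE IHk. Qed.

Lemma iter_map_mxM m n q k (A : 'M[K]_(m, n)) (B : 'M_(n, q)) :
  iter k (map_mx frob) (A *m B) = iter k (map_mx frob) A *m iter k (map_mx frob) B.
Proof. by elim: k => //= k ->; rewrite map_mxM. Qed.

Section TwistedFrobenius.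

Variables (n : nat) (a : 'M[K]_n).
Hypothesis a_unit : a \in unitmx.

(** Its fixed vectors form an F_p-form of K^n, attached to a. *)
Definition twisted_frob (v : 'rV[K]_n) := map_mx frob v *m invmx a.

Lemma twisted_frob_fixed m (y : 'M[K]_(m, n)) :
  (forall i, twisted_frob (row i y) = row i y) -> map_mx frob y = y *m a.
Proof.
move=> yf; apply/row_matrixP => i; rewrite row_mul -yf mulmxKV //.
by rewrite map_row.
Qed.

Lemma twisted_frob_inj : injective twisted_frob.
Proof.
by move=> u v /(congr1 (mulmx^~ a)); rewrite !mulmxKV // => /map_mx_inj.
Qed.

(** The iterates of v have coordinates in the finite subfield generated by the
    entries of v and a^-1. *)
Lemma twisted_frob_periodic v :
  exists2 k, (0 < k)%N & iter k twisted_frob v = v.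
Proof.
have [k k_gt0 kP] := frob_periodic_fin (fun z : 'I_n + 'I_n * 'I_n =>
  match z with inl i => v 0 i | inr (i, j) => invmx a i j end).
have [rs [_ _ rsP]] := fixed_roots k_gt0.
pose vs := map (fun f : {ffun 'I_n -> seq_sub rs} => \row_i ssval (f i))
  (enum {: {ffun 'I_n -> seq_sub rs}}).
apply: (@periodic_of_finite _ vs) => [|i]; first exact: twisted_frob_inj.
set u := iter i _ v; suff uk : iter k (map_mx frob) u = u.
  have urs j : u 0 j \in rs by rewrite rsP -iter_map_mxE uk.
  apply/mapP; exists [ffun j => SeqSub (urs j)]; first by rewrite mem_enum.
  by apply/rowP => j; rewrite mxE ffunE.
rewrite {}/u; elim: i => [|i IHi].
  by apply/rowP => j; rewrite iter_map_mxE (kP (inl j)).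
rewrite /= iter_map_mxM -iterSr /= IHi; congr (_ *m _).
by apply/matrixP => l j; rewrite iter_map_mxE (kP (inr (l, j))).
Qed.

(** Let v have period k.  For c in the field of order p^k, the trace of cv, that
    is sum_(i < k) c^(p^i) t^i(v) for t the twisted Frobenius map, is fixed.  A
    linear form vanishing on all these traces gives a polynomial in c of degree at
    most p^(k-1) with p^k roots, so it kills the coefficient v of c. *)
Lemma twisted_frob_span r (y : 'M[K]_(r, n)) (v : 'rV_n) : ~~ (v <= y)%MS ->
  exists2 u, twisted_frob u = u & ~~ (u <= y)%MS.
Proof.
move=> vy; apply: contrapT => nu; case/negP: vy.
have fixed_sub u : twisted_frob u = u -> u *m cokermx y = 0.
  move=> uf; apply/eqP; rewrite -submxE; apply: contrapT => /negP uy.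
  by apply: nu; exists u.
have [k k_gt0 vk] := twisted_frob_periodic v.
have [rs [rs_uniq rs_size rsP]] := fixed_roots k_gt0.
pose w i := iter i twisted_frob v.
have twZ c u : twisted_frob (c *: u) = c ^+ p *: twisted_frob u.
  by rewrite /twisted_frob map_mxZ scalemxAl.
have twD : {morph twisted_frob : u1 u2 / u1 + u2}.
  by move=> u1 u2; rewrite /twisted_frob map_mxD mulmxDl.
have tw0 : twisted_frob 0 = 0 by rewrite /twisted_frob map_mx0 mul0mx.
have sum_fixed c : c \in rs ->
    twisted_frob (\sum_(i < k) c ^+ (p ^ i) *: w i) = \sum_(i < k) c ^+ (p ^ i) *: w i.
  rewrite rsP => /eqP ck; rewrite (big_morph _ twD tw0).
  under eq_bigr do rewrite twZ -exprM -expnSr.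
  case: k {rs_size rsP} k_gt0 vk ck => // k _ vk ck; rewrite big_ord_recr big_ord_recl /=.
  rewrite addrC ck expn0 expr1; congr (c *: _ + _); exact: vk.
rewrite submxE; apply/eqP/rowP => j; rewrite [RHS]mxE.
pose q := \sum_(i < k) (w i *m cokermx y) 0 j *: 'X^(p ^ i).
have q_rs : all (root q) rs.
  apply/allP => c /sum_fixed/fixed_sub/rowP/(_ j); rewrite [X in _ = X]mxE => q0.
  rewrite /root horner_sum -[X in _ == X]q0 mulmx_suml summxE; apply/eqP.
  by apply: eq_bigr => i _; rewrite hornerZ hornerXn -scalemxAl [RHS]mxE mulrC.
have q0 : q = 0.
  apply: roots_geq_poly_eq0 q_rs rs_uniq _; rewrite rs_size.
  apply: leq_trans (size_sum _ _ _) _; apply/bigmax_leqP => i _.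
  by rewrite (leq_trans (size_scale_leq _ _)) // size_polyXn ltn_exp2l ?prime_gt1.
have := congr1 (coefp 1%N) q0; rewrite /= coef0 coef_sum.
rewrite (bigD1 (Ordinal k_gt0)) //= coefZ coefXn eqxx mulr1 big1 ?addr0 // => i i0.
rewrite coefZ coefXn (_ : (1 == p ^ i)%N = false) ?mulr0 //.
rewrite -{1}(expn0 p) eqn_exp2l ?prime_gt1 // eq_sym.
by move: i0; rewrite -val_eqE => /negPf.
Qed.

(** Lang's theorem for GL_n: fixed vectors span K^n, so a basis of K^n consisting
    of fixed vectors can be built one row at a time. *)
Lemma lang_GL : exists2 y : 'M[K]_n, y \in unitmx & map_mx frob y = y *m a.
Proof.
have [y yf y_free] : exists2 y : 'M[K]_n,
    (forall i, twisted_frob (row i y) = row i y) & row_free y.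
  suff /(_ n (leqnn n)) : forall r, (r <= n)%N -> exists2 y : 'M[K]_(r, n),
    (forall i, twisted_frob (row i y) = row i y) & row_free y by [].
  elim=> [|r IHr] rn.
    by exists 0 => [[]//|]; rewrite -row_leq_rank.
  have [y yf yr] := IHr (ltnW rn).
  have [v vy] : exists v : 'rV_n, ~~ (v <= y)%MS.
    apply: contrapT => /forallNP vy; suff : (1%:M <= y)%MS.
      by move/mxrankS; rewrite mxrank1 (eqP yr) leqNgt rn.
    by apply/row_subP => i; have /negP/negPn := vy (row i 1%:M).
  have [u uf uy] := twisted_frob_span vy.
  rewrite -addn1; exists (col_mx y u) => [i|].
    by case: (split_ordP i) => j ->; rewrite ?rowKu ?rowKd ?row_id // [j]ord1 row_id.
  rewrite -row_leq_rank -addsmxE addn1 -{1}(eqP yr); apply: rank_ltmx.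
  by rewrite ltmxE addsmxSl addsmx_sub submx_refl.
by exists y; [rewrite -row_free_unit | apply: twisted_frob_fixed].
Qed.

End TwistedFrobenius.

End Frobenius.

(** * Automorphism groups of algebras over F_p *)

(** Algebras are given by structure constants with respect to the standard basis
    of row vectors, so that an algebra over k and its scalar extension to K along
    eta are described by the same tensor. *)
Section Tensor.

Variables (k K : fieldType) (eta : {rmorphism k -> K}).

Definition tensor (k : fieldType) n := {ffun 'I_n * 'I_n * 'I_n -> k}.

Definition tmul n (c : tensor k n) (u v : 'rV[K]_n) : 'rV[K]_n :=
  \row_l \sum_i \sum_j (u 0 i * v 0 j) * eta (c (i, j, l)).

Definition thom m n (c : tensor k m) (d : tensor k n) (y : 'M[K]_(m, n)) :=
  forall u v, tmul d (u *m y) (v *m y) = tmul c u v *m y.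

Lemma tmulDl n (c : tensor k n) v : {morph (tmul c)^~ v : u1 u2 / u1 + u2}.
Proof.
move=> u1 u2; apply/rowP => l; rewrite !mxE -big_split; apply: eq_bigr => i _.
by rewrite -big_split; apply: eq_bigr => j _; rewrite mxE !mulrDl.
Qed.

Lemma tmulDr n (c : tensor k n) u : {morph (tmul c) u : v1 v2 / v1 + v2}.
Proof.
move=> v1 v2; apply/rowP => l; rewrite !mxE -big_split; apply: eq_bigr => i _.
by rewrite -big_split; apply: eq_bigr => j _; rewrite mxE mulrDr mulrDl.
Qed.

Lemma tmulZl n (c : tensor k n) x u v : tmul c (x *: u) v = x *: tmul c u v.
Proof.
apply/rowP => l; rewrite !mxE mulr_sumr; apply: eq_bigr => i _.
by rewrite mulr_sumr; apply: eq_bigr => j _; rewrite mxE !mulrA.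
Qed.

Lemma tmulZr n (c : tensor k n) x u v : tmul c u (x *: v) = x *: tmul c u v.
Proof.
apply/rowP => l; rewrite !mxE mulr_sumr; apply: eq_bigr => i _.
by rewrite mulr_sumr; apply: eq_bigr => j _; rewrite mxE mulrCA !mulrA.
Qed.

Lemma tmul0l n (c : tensor k n) v : tmul c 0 v = 0.
Proof. by have := tmulZl c 0 0 v; rewrite !scale0r. Qed.

Lemma tmul0r n (c : tensor k n) u : tmul c u 0 = 0.
Proof. by have := tmulZr c 0 u 0; rewrite !scale0r. Qed.

Lemma tmul_delta n (c : tensor k n) i j :
  tmul c (delta_mx 0 i) (delta_mx 0 j) = \row_l eta (c (i, j, l)).
Proof.
apply/rowP => l; rewrite !mxE (bigD1 i) //= (bigD1 j) //= !mxE !eqxx !mul1r.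
rewrite big1 ?addr0 => [|j' /negPf j'j]; last by rewrite mxE j'j mulr0 mul0r.
rewrite big1 ?addr0 // => i' /negPf i'i; apply: big1 => j' _.
by rewrite mxE i'i !mul0r.
Qed.

Lemma thomP m n (c : tensor k m) (d : tensor k n) (y : 'M[K]_(m, n)) :
  thom c d y <->
  forall i j, tmul d (row i y) (row j y) = \row_l eta (c (i, j, l)) *m y.
Proof.
split=> [cdy i j|cdy u v]; first by rewrite !rowE cdy tmul_delta.
rewrite (row_sum_delta u) (row_sum_delta v) !mulmx_suml.
rewrite !(big_morph _ (tmulDl _ _) (tmul0l _ _)) mulmx_suml; apply: eq_bigr => i _.
rewrite !(big_morph _ (tmulDr _ _) (tmul0r _ _)) mulmx_suml; apply: eq_bigr => j _.
by rewrite -!scalemxAl !tmulZl !tmulZr -!scalemxAl -!rowE cdy tmul_delta.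
Qed.

Lemma thom_comp m n q (c : tensor k m) (d : tensor k n) (e : tensor k q) y z :
  thom c d y -> thom d e z -> thom c e (y *m z).
Proof. by move=> cdy dez u v; rewrite !mulmxA dez cdy. Qed.

Lemma thom_can m n (c : tensor k m) (d : tensor k n) y z :
  y *m z = 1%:M -> z *m y = 1%:M -> thom c d y -> thom d c z.
Proof.
move=> yz zy cdy u v.
by rewrite -{2}[u]mulmx1 -{2}[v]mulmx1 -zy !mulmxA cdy -mulmxA yz mulmx1.
Qed.

Definition taut n (c : tensor k n) : set (affine_space K (n * n)) :=
  [set v | (vec_mx v : 'M[K]_n) \in unitmx /\ thom c c (vec_mx v)].

End Tensor.

Lemma map_tmul (k K : fieldType) (eta : {rmorphism k -> K}) n (c : tensor k n) u v :
  map_mx eta (tmul idfun c u v) = tmul eta c (map_mx eta u) (map_mx eta v).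
Proof.
apply/rowP => l; rewrite !mxE rmorph_sum; apply: eq_bigr => i _.
by rewrite rmorph_sum; apply: eq_bigr => j _; rewrite !rmorphM !mxE.
Qed.

Lemma map_thom (k K : fieldType) (eta : {rmorphism k -> K}) m n
    (c : tensor k m) (d : tensor k n) M :
  thom idfun c d M <-> thom eta c d (map_mx eta M).
Proof.
split=> [cdM|cdM u v]; last first.
  by apply: (@map_mx_inj _ _ eta); rewrite map_tmul !map_mxM cdM map_tmul.
apply/thomP => i j; rewrite -!map_row -map_tmul (iffLR (thomP _ _ _ _) cdM) map_mxM.
by congr (_ *m _); apply/rowP => l; rewrite !mxE.
Qed.

Section Lang.

Variables (p : nat) (p_prime : prime p) (K : closedFieldType).
Variable (eta : {rmorphism 'F_p -> K}).
Hypothesis K_algebraic : integralRange eta.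
Local Notation frob := (frob p_prime eta).
Local Notation tensor n := (tensor 'F_p n).

Lemma frob_tmul n (c : tensor n) u v :
  map_mx frob (tmul eta c u v) = tmul eta c (map_mx frob u) (map_mx frob v).
Proof.
apply/rowP => l; rewrite !mxE rmorph_sum; apply: eq_bigr => i _.
rewrite rmorph_sum; apply: eq_bigr => j _.
by rewrite !rmorphM !mxE eta_fixed.
Qed.

Lemma frob_thom m n (c : tensor m) (d : tensor n) y :
  thom eta c d y -> thom eta c d (map_mx frob y).
Proof.
move=> cdy; apply/thomP => i j; rewrite -!map_row -frob_tmul.
rewrite (iffLR (thomP _ _ _ _) cdy) map_mxM; congr (_ *m _).
by apply/rowP => l; rewrite !mxE eta_fixed.
Qed.

Lemma map_frob_fixed m n (y : 'M[K]_(m, n)) :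
  map_mx frob y = y -> exists z, y = map_mx eta z.
Proof.
move=> yf; have /choice[z zP] (ij : 'I_m * 'I_n) : exists x, y ij.1 ij.2 = eta x.
  by apply: (@frob_fixed _ p_prime); rewrite -[in RHS]yf mxE.
exists (\matrix_(i, j) z (i, j)); apply/matrixP => i j.
by rewrite !mxE -zP.
Qed.

Variables (n : nat) (c : tensor n).
Local Notation X := (affine_space K (n * n)).

Definition trivialized (a y : 'M[K]_n) := y \in unitmx /\ map_mx frob y = y *m a.

(** The points a whose twisted Frobenius, v |-> frob(v) a^-1, has fixed algebra
    isomorphic to the F_p-algebra of structure constants T: the rows of y are a
    basis of that algebra. *)
Definition twist_class (T : tensor n) : set X :=
  [set v | exists2 y, trivialized (vec_mx v) y & thom eta T c y].

(** Fixed vectors multiply to fixed vectors, so the structure constants of a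
    basis of fixed vectors are fixed by Frobenius. *)
Lemma twist_class_cover (v : X) : taut eta c v -> exists T, twist_class T v.
Proof.
move=> [a_unit a_hom]; have [y y_unit yf] := lang_GL p_prime K_algebraic a_unit.
pose t i j := tmul eta c (row i y) (row j y) *m invmx y.
have t_fixed i j : map_mx frob (t i j) = t i j.
  rewrite map_mxM frob_tmul !map_row yf !row_mul a_hom map_invmx yf.
  have ya_unit : y *m vec_mx v \in unitmx by rewrite unitmx_mul y_unit.
  by apply: (canLR (mulmxK ya_unit)); rewrite mulmxA mulmxKV.
have /choice[T TP] (ijl : 'I_n * 'I_n * 'I_n) :
    exists z, t ijl.1.1 ijl.1.2 0 ijl.2 = eta z.
  by have /rowP/(_ ijl.2) := t_fixed ijl.1.1 ijl.1.2; rewrite [LHS]mxE => /frob_fixed.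
exists [ffun ijl => T ijl], y => //; apply/thomP => i j.
rewrite -[LHS](mulmxKV y_unit); congr (_ *m _).
by apply/rowP => l; rewrite [RHS]mxE ffunE -TP.
Qed.

(** Two bases of fixed vectors of the same twisted Frobenius map differ by a
    matrix fixed by Frobenius. *)
Lemma trivialized_trans a y z : trivialized a y -> trivialized a z ->
  exists2 M, z = map_mx eta M *m y & map_mx eta M \in unitmx.
Proof.
move=> [y_unit yf] [z_unit zf].
have [|M ME] := @map_frob_fixed _ _ (z *m invmx y).
  rewrite map_mxM map_invmx yf zf.
  have ya_unit : y *m a \in unitmx by rewrite -yf map_unitmx.
  by apply: (canLR (mulmxK ya_unit)); rewrite mulmxA mulmxKV.
exists M; first by rewrite -ME mulmxKV.
by rewrite -ME unitmx_mul z_unit unitmx_inv.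
Qed.

Lemma map_eta_frob m q (M : 'M_(m, q)) : map_mx frob (map_mx eta M) = map_mx eta M.
Proof. by apply/matrixP => i j; rewrite !mxE eta_fixed. Qed.

(** If T and T' both occur at v, the matrix over F_p comparing the two bases of
    fixed vectors is an isomorphism from T' to T, and it carries bases with
    structure constants T to bases with structure constants T' at any point. *)
Lemma twist_class_sub T T' v : twist_class T v -> twist_class T' v ->
  twist_class T `<=` twist_class T'.
Proof.
move=> [y vy Ty] [z vz T'z] w [x [x_unit xf] Tx].
have [M zE M_unit] := trivialized_trans vy vz.
have [y_unit _] := vy.
exists (map_mx eta M *m x).
  by split; rewrite ?unitmx_mul ?M_unit // map_mxM map_eta_frob xf mulmxA.
apply: thom_comp Tx.
have -> : map_mx eta M = z *m invmx y by rewrite zE mulmxK.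
apply: thom_comp T'z _; apply: thom_can Ty; rewrite ?mulmxV ?mulVmx //.
Qed.

(** The condition on (a, y) is polynomial, and y ranges over a fibre of the kind
    to which elimination applies.  All p^(n^2) points of the fibre over an
    invertible a are obtained from one invertible y as My, for M over F_p. *)
Lemma closed_twist_class T :
  exists2 Z : set X, closed Z & taut eta c `&` twist_class T = taut eta c `&` Z.
Proof.
pose J := ('I_n * 'I_n)%type.
pose ell (s t : J) (v : X) : K := (t.1 == s.1)%:R * vec_mx v t.2 s.2.
pose mat (y : {ffun J -> K}) := \matrix_(i, j) y (i, j).
have coordE i j (v : X) : v 0 (mxvec_index i j) = vec_mx v i j by rewrite mxE.
have ell_regular s t : regular (ell s t).
  apply: regularM; first exact: regular_cst.
  by apply: (regular_ext (coordE _ _)); apply: regular_coord.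
have fibreE v y : frobenius_fibre p ell v y <-> map_mx frob (mat y) = mat y *m vec_mx v.
  have ellE i j : \sum_t ell (i, j) t v * y t = (mat y *m vec_mx v) i j.
    rewrite mxE (eq_bigr (fun t : J => ell (i, j) (t.1, t.2) v * y (t.1, t.2))).
      2: by case.
    rewrite -(pair_bigA _ (fun i' l => ell (i, j) (i', l) v * y (i', l))) /=.
    rewrite (bigD1 i) //= [X in _ + X]big1 ?addr0 => [|i' /negPf i'i].
      by apply: eq_bigr => l _; rewrite /ell eqxx mul1r [mat y i l]mxE mulrC.
    by apply: big1 => l _; rewrite /ell /= i'i !mul0r.
  split=> [vy|vy [i j]].
    by apply/matrixP => i j; rewrite -ellE -vy !mxE.
  by rewrite ellE -vy !mxE.
(* The last equation expresses the invertibility of y polynomially: the fibre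
   equation frob(y) = ya gives det(y)^p = det(y) det(a), and det(a) is not 0. *)
pose f (s : option ('I_n * 'I_n * 'I_n)) (v : X) (y : {ffun J -> K}) : K :=
  if s is Some (i, j, l) then
    tmul eta c (row i (mat y)) (row j (mat y)) 0 l
      - (\row_l eta (T (i, j, l)) *m mat y) 0 l
  else \det (mat y) ^+ p.-1 - \det (vec_mx v : 'M_n).
have p_gt1 := prime_gt1 p_prime.
have red_var i j : reducible p ell (fun _ y => mat y i j).
  apply: reducible_ext (reducible_var p_gt1 ell_regular (i, j)) => x y _.
  by rewrite mxE.
have red_cst z : reducible p ell (fun _ _ => z).
  exact/(reducible_regular p_gt1 ell_regular)/regular_cst.
have redM := @reducibleM _ _ _ _ p_gt1 _ ell_regular.
have red_f s : reducible p ell (f s).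
  case: s => [[[i j] l]|] /=.
    apply: reducible_ext (_ : reducible p ell (fun _ y =>
        (\sum_i' \sum_j' (mat y i i' * mat y j j') * eta (c (i', j', l))) +
        \sum_l' (- eta (T (i, j, l'))) * mat y l' l)).
      move=> v y _; rewrite /f !mxE -sumrN; congr (_ + _).
        by do 2!(apply: eq_bigr => ? _); rewrite !mxE.
      by apply: eq_bigr => ? _; rewrite !mxE mulNr.
    apply: reducibleD.
      apply: reducible_sum => i'; apply: reducible_sum => j'.
      by apply: (redM _ _) => //; apply: (redM _ _).
    by apply: reducible_sum => l'; apply: (redM _ _).
  apply: reducible_ext (_ : reducible p ell (fun v y =>
      \det (mat y) ^+ p.-1 + -1 * \det (vec_mx v : 'M_n))).
    by move=> v y _; rewrite mulN1r.
  apply: reducibleD.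
    exact/(reducibleX p_gt1 ell_regular)/(reducible_det p_gt1 ell_regular).
  apply/(reducible_regular p_gt1 ell_regular).
  apply: regularM; first exact: regular_cst.
  apply: regular_det => i j; apply: (regular_ext (coordE _ _)).
  exact: regular_coord.
have A_sep v : taut eta c v -> exists2 y : reduced J p -> {ffun J -> K},
    injective y & forall b, frobenius_fibre p ell v (y b).
  move=> [v_unit _]; have [y [y_unit yf]] := lang_GL p_prime K_algebraic v_unit.
  pose y_ (b : reduced J p) : {ffun J -> K} :=
    [ffun ij => (map_mx eta (\matrix_(i, j) (b (i, j))%:R) *m y) ij.1 ij.2].
  have y_E b : mat (y_ b) = map_mx eta (\matrix_(i, j) (b (i, j))%:R) *m y.
    by apply/matrixP => i j; rewrite mxE ffunE.
  exists y_ => [b b' bb'|b]; last first.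
    by apply/fibreE; rewrite y_E map_mxM map_eta_frob yf mulmxA.
  have := congr1 (mulmx^~ (invmx y)) (congr1 mat bb').
  rewrite !y_E !mulmxK // => /map_mx_inj/matrixP bE.
  apply/ffunP => -[i j]; apply/val_inj; have := bE i j; rewrite !mxE.
  by move/(congr1 val); rewrite /= !val_Fp_nat // !modn_small.
have [Z clZ ZP] := closed_elimination p_gt1 ell_regular red_f A_sep.
exists Z => //; apply/seteqP; split=> v [Av].
  move=> [y [y_unit yf] Ty]; split=> //; apply/ZP => //.
  have yE : mat [ffun ij => y ij.1 ij.2] = y by apply/matrixP => i j; rewrite mxE ffunE.
  exists [ffun ij => y ij.1 ij.2]; first by apply/fibreE; rewrite yE.
  case=> [[[i j] l]|] /=; rewrite yE.
    by rewrite (iffLR (thomP _ _ _ _) Ty) subrr.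
  apply/eqP; rewrite subr_eq0; apply/eqP.
  have dy : \det y != 0 by rewrite -unitfE -unitmxE.
  apply: (mulfI dy); rewrite -exprS prednK ?prime_gt0 // -det_mulmx -yf.
  by rewrite det_map_mx.
move=> /ZP[] // y vy fy; split=> //; exists (mat y); last first.
  apply/thomP => i j; apply/rowP => l; apply/eqP; rewrite -subr_eq0; apply/eqP.
  exact: (fy (Some (i, j, l))).
split; last exact/fibreE.
have [v_unit _] := Av; have /eqP := fy None; rewrite /= subr_eq0 => /eqP dy.
rewrite unitmxE unitfE; apply: contraTneq v_unit => dy0.
by rewrite unitmxE -dy dy0 expr0n unitfE eqn0Ngt -subn1 subn_gt0 p_gt1 eqxx.
Qed.

(** Lang's theorem for the automorphism group of an algebra.  The finitely many
    twist classes are closed and partition the group, so each of them is also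
    open and the connected set C lies in the class T of v0.  If y0 and y are bases
    of fixed vectors with structure constants T for 1 and for v, then y0^-1 y is
    an automorphism with the required property. *)
Lemma lang_taut (C : set X) v0 v : C `<=` taut eta c -> connected C ->
    C v0 -> C v -> vec_mx v0 = 1%:M :> 'M_n ->
  exists b, [/\ b \in unitmx, thom eta c c b & map_mx frob b = b *m vec_mx v].
Proof.
move=> CA Cc Cv0 Cv v01.
have [T v0T] := twist_class_cover (CA _ Cv0).
have CT : C `&` twist_class T = C.
  apply: Cc; first by exists v0.
    have /choice[Z ZP] T' : exists Z : set X, closed Z /\
        taut eta c `&` twist_class T' = taut eta c `&` Z.
      by have [Z] := closed_twist_class T'; exists Z.
    exists (~` \bigcup_(T' in [set T' | ~ (twist_class T' `<=` twist_class T)]) Z T').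
      apply: closed_openC; apply: closed_bigcup; last by move=> T' _; have [] := ZP T'.
      exact: finite_finset.
    apply/seteqP; split=> w [Cw].
      move=> Tw; split=> // -[T' /= nT' Z'w]; apply: nT'.
      have /seteqP[_ /(_ w)] := proj2 (ZP T').
      by case=> [|_ T'w]; [split=> //; apply: CA | apply: twist_class_sub T'w Tw].
    move=> nw; split=> //; have [T' T'w] := twist_class_cover (CA _ Cw).
    apply: contrapT => nTw; apply: nw; exists T'; first by move=> /(_ w T'w).
    have /seteqP[/(_ w) ZT' _] := proj2 (ZP T').
    by have [] : (taut eta c `&` Z T') w by apply: ZT'; split=> //; apply: CA.
  have [Z clZ ZP] := closed_twist_class T; exists Z => //.
  by have /setIidPl CE := CA; rewrite -CE -2!(setIA C) ZP.
have : (C `&` twist_class T) v by rewrite CT.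
move: v0T => [y0 [y0_unit]]; rewrite v01 mulmx1 => y0f Ty0 [_ [y [y_unit yf] Ty]].
exists (invmx y0 *m y); split.
- by rewrite unitmx_mul unitmx_inv y0_unit.
- apply: thom_comp Ty; apply: thom_can Ty0; rewrite ?mulmxV ?mulVmx //.
- by rewrite map_mxM map_invmx y0f yf mulmxA.
Qed.

End Lang.

(** * Descent of isomorphisms to F_p *)

(** A continuous self-map of A with periodic points permutes the components of A:
    it is injective on them, since some iterate brings two given points back. *)
Section ComponentAction.

Variables (T : topologicalType) (A : set T).
Hypothesis A_fin : finite_set [set connected_component A x | x in A].
Local Notation N := #|` fset_set [set connected_component A x | x in A]|.
Local Notation comp := (connected_component A).

Definition component_map (f : T -> T) :=
  [/\ continuous f, forall x, A x -> A (f x) &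
      forall x, A x -> exists2 k, (0 < k)%N & iter k f x = x].

Variable f : T -> T.
Hypothesis f_map : component_map f.

Lemma component_map_in k x : A x -> A (iter k f x).
Proof. by move=> Ax; elim: k => //= k; have [_ + _] := f_map; apply. Qed.

Lemma component_map_eq k x y : A x -> A y -> comp x = comp y ->
  comp (iter k f x) = comp (iter k f y).
Proof.
move=> Ax Ay xy; elim: k => //= k IHk; have [f_cont fA _] := f_map.
move: (component_map_in k Ax) (component_map_in k Ay) IHk.
move: (iter k f x) (iter k f y) => {xy Ax Ay x y} x y Ax Ay xy.
apply: same_connected_component; exists (f @` comp x); last first.
  by exists y => //; rewrite xy; apply: connected_component_refl.
split; first by exists x => //; apply: connected_component_refl.
  by move=> _ [z /connected_component_sub Az <-]; apply: fA.
apply: connected_continuous_connected; first exact: component_connected.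
exact: continuous_subspaceT.
Qed.

Lemma component_map_inj k x y : A x -> A y ->
  comp (iter k f x) = comp (iter k f y) -> comp x = comp y.
Proof.
move=> Ax Ay; have [_ _ f_per] := f_map.
have [r r_gt0 xr] := f_per x Ax; have [s s_gt0 ys] := f_per y Ay.
move/(component_map_eq (k * (r * s).-1) (component_map_in _ Ax) (component_map_in _ Ay)).
rewrite -!iterD addnC -mulnS prednK ?muln_gt0 ?r_gt0 //.
by rewrite mulnCA iter_period // mulnA mulnC iter_period.
Qed.

(** An orbit of components has at most N elements, so its length divides N!.  The
    finiteness of the set of components matters here, as N is 0 otherwise. *)
Lemma component_map_period k x : A x -> comp (iter (N`! * k) f x) = comp x.
Proof.
move=> Ax; have [|i [j [/andP[ij jN]]]] := @pigeonhole_seq _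
    (enum_fset (fset_set [set comp x | x in A])) (fun i => comp (iter i f x)).
  move=> i; change (comp (iter i f x) \in fset_set [set comp x | x in A]).
  rewrite in_fset_set //; apply/mem_set.
  by exists (iter i f x) => //; apply: component_map_in.
rewrite -(subnKC (ltnW ij)) iterD.
move/(component_map_inj Ax (component_map_in _ Ax)).
set d := (j - i)%N => xd.
have d_gt0 : (0 < d)%N by rewrite subn_gt0.
have /dvdnP[q ->] : (d %| N`!)%N.
  by rewrite dvdn_fact // d_gt0 (leq_trans (leq_subr _ _)).
rewrite mulnAC; elim: (q * k)%N => [|l IHl]; first by rewrite mul0n.
rewrite mulSn addnC iterD -[RHS]IHl.
apply: component_map_eq => //; exact: component_map_in.
Qed.

End ComponentAction.

(** Maps agreeing after m iterations, for m prime to N!, agree on components,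
    because N! iterations of either of them are trivial there. *)
Lemma component_map_coprime (T : topologicalType) (A : set T) m (f g : T -> T) :
    finite_set [set connected_component A x | x in A] ->
    (0 < m)%N ->
    coprime m (#|` fset_set [set connected_component A x | x in A]|)`! ->
    component_map A f -> component_map A g ->
    (forall x, A x -> iter m f x = iter m g x) ->
  forall x, A x -> connected_component A (f x) = connected_component A (g x).
Proof.
move=> A_fin m_gt0 co_m f_map g_map fg x Ax.
(* u m = t N! + 1 *)
have [u t ut _] := egcdnP (#|` fset_set [set connected_component A x | x in A]|)`! m_gt0.
have fgu k : iter (k * m) f x = iter (k * m) g x.
  elim: k => // k IHk; rewrite mulSn !iterD IHk fg //.
  exact: component_map_in.
have := fgu u; rewrite ut (eqP co_m) addn1 !iterSr mulnC.
move=> /(congr1 (connected_component A)); rewrite !component_map_period //.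
  by have [_ + _] := g_map; apply.
by have [_ + _] := f_map; apply.
Qed.

Section Descent.

Variables (p : nat) (p_prime : prime p) (K : closedFieldType).
Variable (eta : {rmorphism 'F_p -> K}).
Hypothesis K_algebraic : integralRange eta.
Local Notation frob := (frob p_prime eta).
Local Notation tensor n := (tensor 'F_p n).

Lemma mxvec_frob_regular n (a : 'M[K]_n) j :
  regular (fun v : affine_space K (n * n) =>
             (mxvec (a *m map_mx frob (vec_mx v)) : affine_space K (n * n)) 0 j).
Proof.
case/mxvec_indexP: j => i j.
apply: regular_ext (_ : regular (fun v : affine_space K (n * n) =>
   \sum_l a i l * v 0 (mxvec_index l j) ^+ p)).
  by move=> v; rewrite mxvecE mxE; apply: eq_bigr => l _; rewrite !mxE.
apply: regular_sum => l; apply: regularM; first exact: regular_cst.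
exact/regularX/regular_coord.
Qed.

Variables (n n' : nat) (c : tensor n) (d : tensor n').
Local Notation X := (affine_space K (n * n)).
Local Notation A := (taut eta c : set X).
Local Notation comps := [set connected_component A v | v in A].

Definition twisted_action (a : 'M[K]_n) (v : X) : X :=
  mxvec (a *m map_mx frob (vec_mx v)).

(** If frob^k fixes the coordinates of v, then the iterate of order km of the
    action of a, being frob^(km), fixes v. *)
Lemma twisted_action_map (m : nat) (a : 'M[K]_n) : (0 < m)%N ->
    A (mxvec a) ->
    (forall v, A v -> iter m (twisted_action a) v = iter m (twisted_action 1%:M) v) ->
  component_map A (twisted_action a).
Proof.
move=> m_gt0; rewrite /taut /= mxvecK => -[a_unit a_hom] am.
have A_act b v : b \in unitmx -> thom eta c c b -> A v -> A (twisted_action b v).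
  move=> b_unit b_hom [v_unit v_hom]; rewrite /taut /= mxvecK; split.
    by rewrite unitmx_mul b_unit map_unitmx.
  by apply: thom_comp b_hom _; apply: frob_thom.
split=> [|v|v Av]; [exact/regular_continuous/mxvec_frob_regular|exact: A_act|].
have iter1 k (w : X) :
    vec_mx (iter k (twisted_action 1%:M) w) = iter k (map_mx frob) (vec_mx w).
  by elim: k => //= k <-; rewrite mxvecK mul1mx.
have hom1 : thom eta c c 1%:M by move=> u w; rewrite !mulmx1.
have A1 k w : A w -> A (iter k (twisted_action 1%:M) w).
  by move=> Aw; elim: k => //= k; apply: A_act hom1; rewrite unitmx1.
have [k k_gt0 kP] := frob_periodic_fin p_prime K_algebraic
  (fun ij : 'I_n * 'I_n => (vec_mx v : 'M_n) ij.1 ij.2).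
have vk : iter k (twisted_action 1%:M) v = v.
  apply: (can_inj (@vec_mxK _ _ _)); rewrite iter1; apply/matrixP => i j.
  by rewrite iter_map_mxE (kP (i, j)).
exists (k * m)%N; first by rewrite muln_gt0 k_gt0.
suff -> : iter (k * m) (twisted_action a) v = iter (k * m) (twisted_action 1%:M) v.
  exact: iter_period.
elim: (k) => // l IHl; rewrite mulSn !iterD IHl am //.
exact: A1.
Qed.

(** The automorphism a = P frob(P)^-1 measures the failure of P to be defined over
    F_p.  The k-th iterate of v |-> a frob(v) is v |-> P frob^k(P^-1) frob^k(v),
    which is frob^m for k = m.  Hence a lies in the component of 1, Lang's theorem
    gives frob(b) = ba, and bP is fixed by Frobenius. *)
Lemma descent (m : nat) (P : 'M[K]_(n, n')) (Q : 'M_(n', n)) :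
    (0 < m)%N -> coprime m (#|` fset_set comps|)`! ->
    P *m Q = 1%:M -> Q *m P = 1%:M -> thom eta c d P ->
    iter m (map_mx frob) Q = Q ->
  exists M : 'M['F_p]_(n, n'), exists N : 'M['F_p]_(n', n),
    [/\ M *m N = 1%:M, N *m M = 1%:M & thom idfun c d M].
Proof.
move=> m_gt0 m_co PQ QP cdP Qm.
pose a := P *m map_mx frob Q.
have sQP : map_mx frob Q *m map_mx frob P = 1%:M by rewrite -map_mxM QP map_mx1.
have aK : a *m (map_mx frob P *m Q) = 1%:M.
  by rewrite mulmxA -(mulmxA P) sQP mulmx1.
have [a_unit _] := mulmx1_unit aK.
have a_hom : thom eta c c a.
  have Qhom := thom_can PQ QP cdP.
  by apply: thom_comp cdP _; apply: frob_thom.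
have Aa : A (mxvec a) by rewrite /taut /= mxvecK.
have A1 : A (mxvec 1%:M).
  by rewrite /taut /= mxvecK unitmx1; split=> // u w; rewrite !mulmx1.
have iter_a k v : vec_mx (iter k (twisted_action a) v) =
    P *m iter k (map_mx frob) Q *m vec_mx (iter k (twisted_action 1%:M) v).
  elim: k => [|k IHk] /=; first by rewrite PQ mul1mx.
  by rewrite !mxvecK IHk /a !map_mxM mul1mx !mulmxA -(mulmxA P) sQP mulmx1.
have am v : A v -> iter m (twisted_action a) v = iter m (twisted_action 1%:M) v.
  move=> _; apply: (can_inj (@vec_mxK _ _ _)); rewrite iter_a.
  by rewrite Qm PQ mul1mx.
have /(_ _ A1) := component_map_coprime (@finite_components _ _ A) m_gt0 m_co
  (twisted_action_map m_gt0 Aa am)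
  (twisted_action_map m_gt0 A1 (fun _ _ => erefl)) am.
rewrite /twisted_action mxvecK map_mx1 !mulmx1 => comp_a.
have comp_sub := @connected_component_sub _ A (mxvec 1%:M).
have [||||b [b_unit b_hom bf]] := @lang_taut _ p_prime _ eta K_algebraic _ c
  (connected_component A (mxvec 1%:M)) (mxvec 1%:M) (mxvec a) comp_sub.
- exact: component_connected.
- exact: connected_component_refl.
- by rewrite -comp_a; apply: connected_component_refl.
- by rewrite mxvecK.
rewrite mxvecK in bf.
have [M ME] : exists M, b *m P = map_mx eta M.
  apply: (@map_frob_fixed _ p_prime); rewrite map_mxM bf /a -!mulmxA.
  by rewrite sQP mulmx1.
have [N NE] : exists N, Q *m invmx b = map_mx eta N.
  apply: (@map_frob_fixed _ p_prime); rewrite map_mxM map_invmx bf.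
  have ba_unit : b *m a \in unitmx by rewrite unitmx_mul b_unit.
  by apply: (canLR (mulmxK ba_unit)); rewrite !mulmxA mulmxKV // QP mul1mx.
exists M, N; split.
- apply: (@map_mx_inj _ _ eta); rewrite map_mxM -ME -NE mulmxA.
  by rewrite -(mulmxA b) PQ mulmx1 mulmxV // map_mx1.
- apply: (@map_mx_inj _ _ eta); rewrite map_mxM -ME -NE mulmxA.
  by rewrite mulmxKV // QP map_mx1.
- by apply/(map_thom eta); rewrite -ME; apply: thom_comp cdP.
Qed.

End Descent.

(** * From structure constants to group algebras *)

Lemma finField_gen (F : finFieldType) :
  exists theta : F, forall x, x != 0 -> exists k, x = theta ^+ k.
Proof.
have /cyclicP[u uE] := field_unit_group_cyclic [group of [set: {unit F}]].
exists (val u) => x x0; have Ux : x \is a GRing.unit by rewrite unitfE.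
have : FinRing.unit F Ux \in <[u]>%g by rewrite -uE inE.
case/cycleP=> k xE; exists k; have := congr1 val xE.
by rewrite FinRing.val_unitX.
Qed.

(** F is generated over F_p by one element theta.  Let q be a polynomial of least
    degree killing theta and t a root of q in K; then evaluation at t factors
    through evaluation at theta. *)
Lemma finField_embedding (p : nat) (F : finFieldType) (K : closedFieldType)
    (iF : {rmorphism 'F_p -> F}) (eta : {rmorphism 'F_p -> K}) :
  inhabited {rmorphism F -> K}.
Proof.
have [theta thetaP] := finField_gen F.
pose ev (q : {poly 'F_p}) : F := (map_poly iF q).[theta].
have evB : {morph ev : q r / q - r} by move=> q r; rewrite /ev rmorphB hornerD hornerN.
have evM : {morph ev : q r / q * r} by move=> q r; rewrite /ev rmorphM hornerM.
have ev1 : ev 1 = 1 by rewrite /ev rmorph1 hornerC.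
have /choice[pre preP] x : exists q, ev q = x.
  have [->|/thetaP[k ->]] := eqVneq x 0.
    by exists 0; rewrite -(subrr 0) evB subrr.
  by exists 'X^k; rewrite /ev map_polyXn hornerXn.
have [q q_neq0 [evq q_min]] : exists2 q, q != 0 &
    ev q = 0 /\ forall r, ev r = 0 -> (size r < size q)%N -> r = 0.
  pose bad k := `[< exists q, [/\ q != 0, ev q = 0 & size q = k] >].
  have exb : exists k, bad k.
    pose q : {poly 'F_p} := 'X^#|F| - 'X.
    exists (size q); apply/asboolP; exists q; split=> //.
      rewrite subr_eq0; apply/eqP => /(congr1 (size \o val)) /=.
      rewrite size_polyXn size_polyX => -[F1].
      by have := finNzRing_gt1 F; rewrite F1.
    by rewrite /ev rmorphB /= map_polyXn map_polyX !hornerE expf_card subrr.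
  have [k /asboolP[q [q0 evq szq]] k_min] := ex_minnP exb.
  exists q => //; split=> // r evr; apply: contraTeq => r0.
  by rewrite -leqNgt szq; apply: k_min; apply/asboolP; exists r.
have q_dvd r : ev r = 0 -> q %| r.
  move=> evr; rewrite /dvdp; apply/eqP/q_min; last by rewrite ltn_modp.
  have -> : r %% q = r - r %/ q * q by rewrite {2}(divp_eq r q) addrC addKr.
  by rewrite evB evM evr evq mulr0 subrr.
have [t qt] : exists t, root (map_poly eta q) t.
  apply/closed_rootP; rewrite size_map_poly; apply/negP => /size_poly1P[z z0 qz].
  move: evq; rewrite qz /ev map_polyC hornerC => /eqP.
  by rewrite fmorph_eq0 (negPf z0).
pose et (r : {poly 'F_p}) : K := (map_poly eta r).[t].
have etE r s : ev r = ev s -> et r = et s.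
  move=> rs; suff : (map_poly eta (r - s)).[t] = 0.
    by rewrite rmorphB hornerD hornerN => /subr0_eq.
  have /q_dvd : ev (r - s) = 0 by rewrite evB rs subrr.
  rewrite -(dvdp_map eta) => /dvdpP[w ->].
  by rewrite hornerM (rootP qt) mulr0.
pose j x := et (pre x).
have jB : zmod_morphism j.
  move=> x y; rewrite /j (etE _ (pre x - pre y)) ?evB ?preP //.
  by rewrite /et rmorphB hornerD hornerN.
have jM : monoid_morphism j.
  split=> [|x y]; first by rewrite /j (etE _ 1) ?preP ?ev1 // /et rmorph1 hornerC.
  rewrite /j (etE _ (pre x * pre y)) ?evM ?preP //.
  by rewrite /et rmorphM hornerM.
pose jA := GRing.isZmodMorphism.Build F K j jB.
pose jR := GRing.isMonoidMorphism.Build F K j jM.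
pose J : {rmorphism F -> K} := HB.pack j jA jR.
by exists.
Qed.

Section GroupTensor.

Variables (k K : fieldType) (eta : {rmorphism k -> K}).

Definition gtensor (gT : finGroupType) : tensor k #|gT| :=
  [ffun ijl => ((enum_val ijl.1.1 * enum_val ijl.1.2)%g == enum_val ijl.2)%:R].

Definition gcoord (gT : finGroupType) (a : galg K gT) : 'rV[K]_#|gT| :=
  \row_i gcoef a (enum_val i).

Definition gvect (gT : finGroupType) (v : 'rV[K]_#|gT|) : galg K gT :=
  \sum_i v 0 i *: gelt K (enum_val i).

Lemma gvect_coef (gT : finGroupType) v i : gcoef (@gvect gT v) (enum_val i) = v 0 i.
Proof.
rewrite gcoef_sum (bigD1 i) //= big1 ?addr0 => [|l li].
  by rewrite gcoefZ ffunE eqxx mulr1.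
by rewrite gcoefZ ffunE (inj_eq enum_val_inj) eq_sym (negPf li) mulr0.
Qed.

Lemma gvectK (gT : finGroupType) : cancel (@gvect gT) (@gcoord gT).
Proof. by move=> v; apply/rowP => i; rewrite mxE gvect_coef. Qed.

Lemma gcoordK (gT : finGroupType) : cancel (@gcoord gT) (@gvect gT).
Proof.
move=> a; apply/galgP => g; rewrite -(enum_rankK g).
by rewrite gvect_coef mxE.
Qed.

Lemma gcoordM (gT : finGroupType) (a b : galg K gT) :
  gcoord (a * b) = tmul eta (gtensor gT) (gcoord a) (gcoord b).
Proof.
apply/rowP => l; rewrite !mxE gcoefM (reindex _ (onW_bij _ (enum_val_bij gT))) /=.
apply: eq_bigr => i _.
rewrite (bigD1 (enum_rank ((enum_val i)^-1 * enum_val l)%g)) //= big1 => [|j jl].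
  by rewrite addr0 !mxE ffunE enum_rankK mulKVg eqxx rmorph1 mulr1.
rewrite ffunE /= (_ : (_ == _) = false) ?rmorph0 ?mulr0 //.
apply: contraNF jl => /eqP <-; by rewrite mulKg enum_valK.
Qed.

Lemma gcoordD (gT : finGroupType) : {morph (@gcoord gT) : a b / a + b}.
Proof. by move=> a b; apply/rowP => i; rewrite !mxE gcoefD. Qed.

Lemma gcoordZ (gT : finGroupType) x (a : galg K gT) : gcoord (x *: a) = x *: gcoord a.
Proof. by apply/rowP => i; rewrite !mxE gcoefZ. Qed.

Definition glin (gT hT : finGroupType) (M : 'M[K]_(#|gT|, #|hT|)) (a : galg K gT) :
  galg K hT := gvect (gcoord a *m M).

Lemma glin_thom (gT hT : finGroupType) (M : 'M[K]_(#|gT|, #|hT|)) :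
  {morph glin M : a b / a * b} <-> thom eta (gtensor gT) (gtensor hT) M.
Proof.
split=> [mM u v|mM a b]; last first.
  by apply: (can_inj (@gcoordK hT)); rewrite gcoordM !gvectK mM gcoordM.
have := congr1 (@gcoord hT) (mM (gvect u) (gvect v)).
by rewrite gcoordM /glin !gvectK gcoordM !gvectK => <-.
Qed.

End GroupTensor.

Lemma galg_endoE (K : fieldType) (gT : finGroupType) (M : 'M[K]_#|gT|) :
  galg_endo M =1 glin M.
Proof.
move=> a; rewrite /galg_endo exchange_big; apply: eq_bigr => j _.
by rewrite -scaler_suml mxE; congr (_ *: _); apply: eq_bigr => i _; rewrite mxE.
Qed.

(** A bijective multiplicative map preserves the unit. *)
Lemma galg_autE (k K : fieldType) (eta : {rmorphism k -> K})
    (gT : finGroupType) :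
  @galg_aut K gT = taut eta (gtensor k gT).
Proof.
apply/seteqP; split=> v [v_unit]; rewrite /= => vM; split=> //.
  apply/glin_thom => a b; rewrite -!galg_endoE; by case: vM => _; apply.
have {}vM a b : galg_endo (vec_mx v) (a * b) =
    galg_endo (vec_mx v) a * galg_endo (vec_mx v) b.
  by rewrite !galg_endoE; exact: (iffRL (glin_thom eta _) vM).
split=> //; pose z := gvect (gcoord (1 : galg K gT) *m invmx (vec_mx v)).
have z1 : galg_endo (vec_mx v) z = 1.
  by rewrite galg_endoE /glin gvectK mulmxKV // gcoordK.
by have := vM 1 z; rewrite mul1r z1 mulr1 => <-.
Qed.

Definition gmatrix (F : fieldType) (gT hT : finGroupType)
    (f : galg F gT -> galg F hT) : 'M[F]_(#|gT|, #|hT|) :=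
  \matrix_(i, j) gcoef (f (gelt F (enum_val i))) (enum_val j).

Lemma gmatrixE (F : fieldType) (gT hT : finGroupType)
    (f : {linear galg F gT -> galg F hT}) a :
  gcoord (f a) = gcoord a *m gmatrix f.
Proof.
rewrite -{1}(gcoordK a) linear_sum; apply/rowP => j; rewrite !mxE gcoef_sum.
by apply: eq_bigr => i _; rewrite linearZ gcoefZ !mxE.
Qed.

(** The structure constants of a group algebra are 0 and 1, over any field. *)
Lemma tmul_gtensor (k k' K : fieldType) (j : {rmorphism k -> K})
    (j' : {rmorphism k' -> K}) (gT : finGroupType) u v :
  tmul j (gtensor k gT) u v = tmul j' (gtensor k' gT) u v.
Proof.
apply/rowP => l; rewrite !mxE; do 2!(apply: eq_bigr => ? _).
by rewrite !ffunE !rmorph_nat.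
Qed.

Lemma group_algebra_descent (p : nat) (p_prime : prime p)
    (gT hT : finGroupType) (K : closedFieldType) (eta : {rmorphism 'F_p -> K})
    (K_algebraic : integralRange eta) (m : nat) (m_gt0 : (0 < m)%N)
    (m_coprime : coprime m (num_aut_components K gT)`!)
    (F : finFieldType) (F_card : #|F| = (p ^ m)%N) :
  (exists f : {lrmorphism galg F gT -> galg F hT}, bijective f) ->
  exists f : {lrmorphism galg 'F_p gT -> galg 'F_p hT}, bijective f.
Proof.
move=> [f [g fK gK]].
have F_char := card_finPcharP F_card p_prime.
pose iF : {rmorphism 'F_p -> pPrimeCharType F_char} := GRing.in_alg _.
have [j] := @finField_embedding p F K iF eta.
have frob_j x : iter m (frob p_prime eta) (j x) = j x.
  by rewrite iter_frobE -rmorphXn -F_card expf_card.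
pose gl := GRing.isLinear.Build F _ _ _ g (can2_linear fK gK).
pose g' : {linear galg F hT -> galg F gT} := HB.pack g gl.
have PQ : gmatrix f *m gmatrix g' = 1%:M.
  apply/row_matrixP => i; rewrite !rowE mulmx1 -[delta_mx 0 i]gvectK mulmxA.
  by rewrite -!gmatrixE /= fK.
have QP : gmatrix g' *m gmatrix f = 1%:M.
  apply/row_matrixP => i; rewrite !rowE mulmx1 -[delta_mx 0 i]gvectK mulmxA.
  by rewrite -!gmatrixE /= gK.
have f_hom : thom eta (gtensor 'F_p gT) (gtensor 'F_p hT) (map_mx j (gmatrix f)).
  have : thom idfun (gtensor F gT) (gtensor F hT) (gmatrix f).
    apply/glin_thom => a b; rewrite /glin -!gmatrixE !gcoordK; exact: rmorphM.
  move=> /(map_thom j) hom u v.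
  by rewrite -!(tmul_gtensor j); apply: hom.
have := m_coprime; rewrite /num_aut_components /aut_components (galg_autE eta).
move=> co; have [||||M [N [MN NM M_hom]]] := @descent _ p_prime K eta K_algebraic _ _
  _ (gtensor 'F_p hT) m (map_mx j (gmatrix f)) (map_mx j (gmatrix g')) m_gt0 co.
- by rewrite -map_mxM PQ map_mx1.
- by rewrite -map_mxM QP map_mx1.
- exact: f_hom.
- apply/matrixP => i l; rewrite iter_map_mxE -(iter_frobE p_prime eta) !mxE.
  exact: frob_j.
have hB : linear (glin M).
  move=> x a b; apply: (can_inj (@gcoordK _ hT)).
  by rewrite gcoordD gcoordZ !gvectK gcoordD gcoordZ mulmxDl scalemxAl.
have hM := iffRL (glin_thom idfun M) M_hom.
have hK : cancel (glin M) (glin N).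
  by move=> a; rewrite /glin gvectK -mulmxA MN mulmx1 gcoordK.
have hK' : cancel (glin N) (glin M).
  by move=> a; rewrite /glin gvectK -mulmxA NM mulmx1 gcoordK.
have h1 : glin M 1 = 1.
  by have := hM 1 (glin N 1); rewrite mul1r hK' mulr1 => <-.
pose hL := GRing.isLinear.Build 'F_p _ _ _ (glin M) hB.
pose hR := GRing.isMonoidMorphism.Build _ _ (glin M) (conj h1 hM : monoid_morphism _).
pose h : {lrmorphism galg 'F_p gT -> galg 'F_p hT} := HB.pack (glin M) hL hR.
by exists h; exists (glin N).
Qed.

Local Close Scope classical_set_scope.

(** * Powers of the augmentation ideal *)

Lemma mul_sub1 (R : pzRingType) (a b : R) :
  a * b - 1 = (a - 1) * (b - 1) + (a - 1) + (b - 1).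
Proof. by rewrite -{2}[a - 1]mulr1 -mulrDr subrK mulrBl mul1r addrA subrK. Qed.

Section AugmentationIdeal.

Variables (F : fieldType) (gT : finGroupType).
Local Notation A := (galg F gT).
Local Notation I := (aug_ideal F gT).
Implicit Types (a b x y : A) (g h : gT) (n : nat).

Lemma aug_gelt g : augmentation (gelt F g) = 1.
Proof.
rewrite /augmentation (bigD1 g) //= big1 ?addr0 => [|h /negPf hg].
  by rewrite ffunE eqxx.
by rewrite ffunE hg.
Qed.

Lemma aug1 : augmentation (1 : A) = 1. Proof. exact: aug_gelt. Qed.

Lemma augM a b : augmentation (a * b) = augmentation a * augmentation b.
Proof.
rewrite {1}/augmentation; under eq_bigr do rewrite gcoefM.
rewrite exchange_big mulr_suml; apply: eq_bigr => g _ /=.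
rewrite -mulr_sumr (reindex_inj (mulgI g)) /=; congr (_ * _).
by apply: eq_bigr => h _; rewrite mulKg.
Qed.

Lemma aug_idealE a : (a \in I) = (augmentation a == 0).
Proof. exact: mem_aug_ideal. Qed.

Lemma gelt_sub1_aug g : gelt F g - 1 \in I.
Proof. by rewrite aug_idealE linearB /= aug_gelt aug1 subrr. Qed.

Lemma aug_ideal_span a : a \in I ->
  a = \sum_g gcoef a g *: (gelt F g - 1).
Proof.
rewrite mem_aug_ideal => /eqP a0; under eq_bigr do rewrite scalerBr.
by rewrite sumrB -galg_sum_gelt -scaler_suml a0 scale0r subr0.
Qed.

Lemma aug_powS x y n : x \in I -> y \in (I ^+ n)%VS -> x * y \in (I ^+ n.+1)%VS.
Proof. by rewrite expvSl => xI yI; apply: memv_mul. Qed.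

Lemma aug_powM x y m n : x \in (I ^+ m)%VS -> y \in (I ^+ n)%VS ->
  x * y \in (I ^+ (m + n))%VS.
Proof. by rewrite expvD => xI yI; apply: memv_mul. Qed.

Lemma aug_pow_mulr a x n : x \in (I ^+ n.+1)%VS -> x * a \in (I ^+ n.+1)%VS.
Proof.
move=> xI; suff: (I ^+ n.+1 * fullv <= I ^+ n.+1)%VS.
  by move/subvP; apply; apply: memv_mul; rewrite ?memvf.
rewrite expvSr -prodvA prodvSr //; apply/prodvP => u v.
by rewrite !aug_idealE augM => /eqP-> _; rewrite mul0r.
Qed.

Lemma aug_pow_mull a x n : x \in (I ^+ n.+1)%VS -> a * x \in (I ^+ n.+1)%VS.
Proof.
move=> xI; suff: (fullv * I ^+ n.+1 <= I ^+ n.+1)%VS.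
  by move/subvP; apply; apply: memv_mul; rewrite ?memvf.
rewrite expvSl prodvA prodvSl //; apply/prodvP => u v _.
by rewrite !aug_idealE augM => /eqP->; rewrite mulr0.
Qed.

Lemma aug_pow_sub n : (I ^+ n.+2 <= I ^+ n.+1)%VS.
Proof.
rewrite expvSl; apply/prodvP => u v _; exact: aug_pow_mull.
Qed.

Lemma aug_exp x n k : x \in I -> (n.+1 <= k)%N -> x ^+ k \in (I ^+ n.+1)%VS.
Proof.
move=> xI /subnKC <-; rewrite exprD; apply: aug_pow_mulr.
elim: n => [|n IHn]; first by rewrite expv1.
by rewrite exprS; apply: aug_powS.
Qed.

End AugmentationIdeal.

Lemma aug_ideal_ind (F : fieldType) (gT : finGroupType) (P : galg F gT -> Prop) :
    (forall x y, P x -> P y -> P (x + y)) -> (forall k x, P x -> P (k *: x)) ->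
    (forall g, P (gelt F g - 1)) ->
  forall x, x \in aug_ideal F gT -> P x.
Proof.
move=> PD PZ Pg x /aug_ideal_span ->.
elim/big_ind: _ => [|//|g _]; last exact/PZ/Pg.
by rewrite -(scale0r (gelt F 1%g - 1)); apply/PZ/Pg.
Qed.

Section Transport.

Variables (p : nat) (p_prime : prime p) (gT hT : finGroupType).
Hypothesis G_pgroup : (p.-group [set: gT]%g)%g.
Local Notation A := (galg 'F_p gT).
Local Notation B := (galg 'F_p hT).
Variable f : {lrmorphism A -> B}.

(** F_p has no nontrivial p-power roots of unity, so every algebra map to F_p
    sends the group elements to 1. *)
Lemma lrmorphism_aug a : augmentation (f a) = augmentation a.
Proof.
have fg g : augmentation (f (gelt _ g)) = 1.
  set z : 'F_p := augmentation _.
  have [k Gk] := p_natP G_pgroup.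
  have zX n : augmentation (f (gelt _ (g ^+ n)%g)) = z ^+ n.
    elim: n => [|n IHn]; first by rewrite expg0 gelt1 rmorph1 aug1.
    by rewrite expgS geltM rmorphM /= augM IHn exprS.
  have : z ^+ (p ^ k) = 1.
    by rewrite -zX -Gk expg_cardG ?inE // gelt1 rmorph1 aug1.
  have zp : z ^+ p = z by rewrite -{2}[z]expf_card card_Fp.
  by elim: k {Gk} => // k IHk; rewrite expnS exprM zp.
rewrite {1}(galg_sum_gelt a) !linear_sum; apply: eq_bigr => g _ /=.
by rewrite !linearZ /= fg; apply: mulr1.
Qed.

Lemma lrmorphism_pow n a : a \in (aug_ideal 'F_p gT ^+ n.+1)%VS ->
  f a \in (aug_ideal 'F_p hT ^+ n.+1)%VS.
Proof.
rewrite -[f a](lfunE f) memv_preim; apply/subvP.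
elim: n => [|n IHn].
  apply/subvP => x; rewrite -memv_preim lfunE /= !expv1 !aug_idealE.
  by rewrite lrmorphism_aug.
rewrite expvSl; apply/prodvP => u v uI vI.
rewrite -memv_preim lfunE rmorphM /= aug_powS //.
  by rewrite aug_idealE lrmorphism_aug -aug_idealE.
by have /subvP/(_ v vI) := IHn; rewrite -memv_preim lfunE.
Qed.

End Transport.

Section Frattini.

Variables (p : nat) (p_prime : prime p) (gT : finGroupType).
Hypothesis G_pgroup : (p.-group [set: gT]%g)%g.
Local Notation A := (galg 'F_p gT).
Local Notation I := (aug_ideal 'F_p gT).
Local Notation Phi := 'Phi([set: gT]%g)%g.
Local Notation ge := (gelt 'F_p).

(** For a p-group, Phi(G) is generated by commutators and p-th powers. *)
Lemma Phi_ind (P : gT -> Prop) :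
    P 1%g -> (forall x y, P x -> P y -> P (x * y)%g) ->
    (forall x y, P [~ x, y]%g) -> (forall x, P (x ^+ p)%g) ->
  forall x, x \in Phi -> P x.
Proof.
move=> P1 PM PR PX x; pose S := [set x | `[< P x >]]%SET.
have SP y : reflect (P y) (y \in S) by rewrite finset.in_set; apply: asboolP.
have gS : group_set S.
  by apply/group_setP; split=> [|y z /SP Py /SP Pz]; apply/SP => //; apply: PM.
suff /fintype.subsetP PS : Phi \subset Group gS by move=> /PS/SP.
rewrite (Phi_joing G_pgroup) join_subG; apply/andP; split.
  rewrite gen_subG; apply/fintype.subsetP => _ /imset2P[y z _ _ ->].
  exact/SP.
rewrite (MhoE 1 G_pgroup) gen_subG; apply/fintype.subsetP => _ /imsetP[y _ ->].
by rewrite expn1; apply/SP.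
Qed.

(** A group element g outside a maximal subgroup M is detected modulo I^2 by the
    linear extension lam of the additive character chi : G -> G/M = F_p, since
    lam((x - 1)(y - 1)) = chi(xy) - chi(x) - chi(y) = 0. *)
Lemma D2_Phi g : ge g - 1 \in (I ^+ 2)%VS -> g \in Phi.
Proof.
move=> gI; apply: contrapT => /negP g_Phi.
have [M maxM gM] : exists2 M : {group gT}, maximal M [set: gT]%g & g \notin M.
  apply: contrapT => nM; case/negP: g_Phi; apply/bigcapP => M.
  rewrite /maximal_eq => /orP[/eqP->|maxM]; first by rewrite inE.
  by apply: contrapT => /negP gM; apply: nM; exists M.
have nMG := p_maximal_normal G_pgroup maxM.
have iMG := p_maximal_index G_pgroup maxM.
have cardQ : #|([set: gT]%g / M)%g| = p by rewrite card_quotient ?normal_norm.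
have [c cE] : exists c, ([set: gT]%g / M)%g = <[c]>%g.
  by apply/cyclicP/prime_cyclic; rewrite cardQ.
have c_ord : #[c]%g = p by rewrite orderE -cE.
have NM x : x \in ('N(M))%g by apply: (fintype.subsetP (normal_norm nMG)); rewrite inE.
have /choice[e eP] x : exists e, coset M x = (c ^+ e)%g.
  have : coset M x \in <[c]>%g by rewrite -cE mem_quotient ?inE.
  by case/cycleP=> e ->; exists e.
pose chi x : 'F_p := (e x)%:R.
have chiM x y : chi (x * y)%g = chi x + chi y.
  rewrite /chi -natrD; apply/val_inj; rewrite /= !val_Fp_nat //; apply/eqP.
  by rewrite -c_ord -eq_expg_mod_order -eP morphM // expgD -!eP.
have chi1 : chi 1%g = 0 by apply: (addIr (chi 1%g)); rewrite -chiM mulg1 add0r.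
have chig : chi g != 0.
  apply: contra gM => /eqP/(congr1 val); rewrite /= val_Fp_nat // => /eqP eg.
  apply: coset_idr => //; rewrite eP; apply/eqP.
  by rewrite -order_dvdn c_ord /dvdn eg.
pose lam (a : A) : ('F_p)^o := \sum_x gcoef a x * chi x.
have lam_lin : linear lam.
  move=> k a b; rewrite /lam scaler_sumr -big_split; apply: eq_bigr => x _.
  by rewrite gcoefD gcoefZ mulrDl -mulrA.
pose lamL : {linear A -> ('F_p)^o} :=
  HB.pack lam (GRing.isLinear.Build _ _ _ _ lam lam_lin).
have lam_gelt x : lam (ge x) = chi x.
  rewrite /lam (bigD1 x) //= ffunE eqxx mul1r big1 ?addr0 // => y /negPf yx.
  by rewrite ffunE yx mul0r.
have lam_gen x y : lamL ((ge x - 1) * (ge y - 1)) = 0.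
  rewrite mulrBl mul1r mulrBr mulr1 -geltM -gelt1 !linearB /= !lam_gelt chiM chi1.
  by rewrite opprK addr0 [chi x + _]addrC addrK subrr.
suff : (I ^+ 2 <= lker (linfun lamL))%VS.
  move/subvP/(_ _ gI); rewrite memv_ker lfunE -gelt1 linearB /= !lam_gelt chi1.
  by rewrite subr0 (negPf chig).
rewrite (expvSl _ 1) expv1; apply/prodvP => u v uI vI.
rewrite memv_ker lfunE (aug_ideal_span uI) (aug_ideal_span vI).
rewrite mulr_suml linear_sum big1 // => x _.
rewrite mulr_sumr linear_sum big1 // => y _.
by rewrite -scalerAl -scalerAr !linearZ lam_gen /= !scaler0.
Qed.

End Frattini.

(** * The Frattini part of the square of the augmentation ideal *)

(** When products of two elements of S - 1 lie in V, the rule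
    de - 1 = (d - 1)(e - 1) + (d - 1) + (e - 1) makes the image of S - 1 modulo V
    an additive group, hence an F_p-space. *)
Section GroupLikeModulo.

Variables (p : nat) (gT : finGroupType).
Local Notation A := (galg 'F_p gT).
Local Notation ge := (gelt 'F_p).
Variables (S : {group gT}) (V : {vspace A}).
Hypothesis SV : forall d e, d \in S -> e \in S -> (ge d - 1) * (ge e - 1) \in V.

Definition grouplike_mod (x : A) := exists2 d, d \in S & x - (ge d - 1) \in V.

Lemma grouplike_modD x y :
  grouplike_mod x -> grouplike_mod y -> grouplike_mod (x + y).
Proof.
move=> [d Sd xd] [e Se ye]; exists (d * e)%g; first exact: groupM.
have -> : x + y - (ge (d * e)%g - 1) =
    (x - (ge d - 1)) + (y - (ge e - 1)) - (ge d - 1) * (ge e - 1).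
  rewrite geltM mul_sub1; move: (ge d - 1) (ge e - 1) => u v.
  by rewrite -addrA !opprD addrACA -!addrA [- (u * v) + _]addrC -!addrA.
by apply: rpredB; [apply: rpredD | apply: SV].
Qed.

Lemma grouplike_mod_ideal x : x \in V -> grouplike_mod x.
Proof. by move=> Vx; exists 1%g; rewrite ?group1 // gelt1 subrr subr0. Qed.

Lemma grouplike_modZ (k : 'F_p) x : grouplike_mod x -> grouplike_mod (k *: x).
Proof.
move=> Sx; rewrite -[k]natr_Zp scaler_nat; elim: (k : nat) => [|n IHn].
  by apply: grouplike_mod_ideal; rewrite mulr0n rpred0.
by rewrite mulrS; apply: grouplike_modD.
Qed.

Lemma grouplike_mod_sum (J : Type) (r : seq J) (E : J -> A) :
  (forall j, grouplike_mod (E j)) -> grouplike_mod (\sum_(j <- r) E j).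
Proof.
move=> SE; elim: r => [|j r IHr].
  by apply: grouplike_mod_ideal; rewrite big_nil rpred0.
by rewrite big_cons; apply: grouplike_modD.
Qed.

Definition grouplike_space : {vspace A} :=
  (<<[seq ge d - 1 | d <- enum S]>> + V)%VS.

Lemma grouplike_spaceP x : x \in grouplike_space <-> grouplike_mod x.
Proof.
split=> [/memv_addP[u uS [v vV ->]]|[d Sd xd]].
  apply: grouplike_modD (grouplike_mod_ideal vV).
  rewrite (coord_span uS); apply: grouplike_mod_sum => i; apply: grouplike_modZ.
  have /mapP[d] :
      [seq ge d - 1 | d <- enum S]`_i \in [seq ge d - 1 | d <- enum S].
    by apply: mem_nth; rewrite size_map -cardE; apply: ltn_ord.
  rewrite mem_enum => Sd ->; exists d => //.
  by rewrite subrr rpred0.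
rewrite -(subrK (ge d - 1) x) addrC; apply: memv_add => //.
by apply/memv_span/map_f; rewrite mem_enum.
Qed.

End GroupLikeModulo.

Lemma bracketDl (R : pzRingType) (u v y : R) :
  (u + v) * y - y * (u + v) = (u * y - y * u) + (v * y - y * v).
Proof. by rewrite mulrDl mulrDr opprD addrACA. Qed.

Lemma bracketDr (R : pzRingType) (x u v : R) :
  x * (u + v) - (u + v) * x = (x * u - u * x) + (x * v - v * x).
Proof. by rewrite mulrDl mulrDr opprD addrACA. Qed.

Section FrattiniPart.

Variables (p : nat) (p_prime : prime p) (gT : finGroupType).
Hypothesis G_pgroup : (p.-group [set: gT])%g.
Local Notation A := (galg 'F_p gT).
Local Notation I := (aug_ideal 'F_p gT).
Local Notation ge := (gelt 'F_p).
Local Notation Phi := 'Phi([set: gT])%G.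

Lemma pchar_galg : p \in [pchar A].
Proof.
rewrite !inE p_prime /= -[p%:R]/((1 : A) *+ p) -scaler_nat.
by rewrite (pcharf0 (pchar_Fp p_prime)) scale0r.
Qed.

Lemma bracket_pow2 x y : x \in I -> y \in I -> x * y - y * x \in (I ^+ 2)%VS.
Proof.
by move=> xI yI; apply: rpredB; apply: (@aug_powS _ _ _ _ 1); rewrite ?expv1.
Qed.

(** Commutators and p-th powers in a group of units, expressed by the ring
    operations on the elements u - 1.  This is applied to the group
    itself and to the image of another group under an algebra isomorphism. *)
Section Multiplicative.

Variables (kT : finGroupType) (phi : kT -> A).
Hypotheses (phi1 : phi 1%g = 1) (phiM : {morph phi : x y / (x * y)%g >-> x * y}).

Lemma phi_comm x y : phi [~ x, y]%g - 1 =
  phi (x^-1 * y^-1)%g * ((phi x - 1) * (phi y - 1) - (phi y - 1) * (phi x - 1)).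
Proof.
have -> : (phi x - 1) * (phi y - 1) - (phi y - 1) * (phi x - 1) =
    phi x * phi y - phi y * phi x.
  have mulB1 (a b : A) : (a - 1) * (b - 1) = a * b - (a + b - 1).
    by rewrite mulrBl mul1r mulrBr mulr1 -addrA -opprD addrA.
  rewrite !mulB1 [phi y + _]addrC; set c := _ - 1.
  by rewrite (opprB _ c) addrA subrK.
rewrite mulrBr -!phiM -!mulgA [(x^-1 * (y^-1 * (y * x)))%g](_ : _ = 1%g).
  by rewrite phi1 commgEl conjgE.
by rewrite mulKg mulVg.
Qed.

Lemma phi_exp x : phi (x ^+ p)%g - 1 = (phi x - 1) ^+ p.
Proof.
have phiX n : phi (x ^+ n)%g = phi x ^+ n.
  by elim: n => [|n IHn]; rewrite ?expg0 // expgS exprS phiM IHn.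
have := pFrobenius_autB_comm pchar_galg (commr1 (phi x)).
by rewrite !pFrobenius_autE expr1n phiX.
Qed.

End Multiplicative.

Lemma commg_Phi g h : [~ g, h]%g \in Phi.
Proof.
rewrite /= (Phi_joing G_pgroup); apply: (fintype.subsetP (joing_subl _ _)).
by apply: mem_commg; rewrite finset.in_setT.
Qed.

Lemma expg_Phi g : (g ^+ p)%g \in Phi.
Proof.
rewrite /= (Phi_joing G_pgroup); apply: (fintype.subsetP (joing_subr _ _)).
rewrite -[p in (g ^+ p)%g]expn1; apply: Mho_p_elt; first by rewrite finset.in_setT.
by apply: mem_p_elt G_pgroup _; rewrite finset.in_setT.
Qed.

Lemma Phi_pow2 d : d \in Phi -> ge d - 1 \in (I ^+ 2)%VS.
Proof.
move=> dPhi; apply: (Phi_ind G_pgroup (P := fun d => ge d - 1 \in (I ^+ 2)%VS)) dPhi.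
- by rewrite gelt1 subrr rpred0.
- move=> x y xI yI; rewrite geltM mul_sub1.
  by apply: rpredD => //; apply: rpredD => //; apply: aug_pow_mulr.
- move=> x y; rewrite (phi_comm (gelt1 _ _) (@geltM _ _)).
  by apply/aug_pow_mull/bracket_pow2; apply: gelt_sub1_aug.
- move=> x; rewrite (phi_exp (gelt1 _ _) (@geltM _ _)).
  by apply: aug_exp; rewrite ?gelt_sub1_aug ?prime_gt1.
Qed.

Lemma Phi_mul_pow3 d e : d \in Phi -> e \in Phi ->
  (ge d - 1) * (ge e - 1) \in (I ^+ 3)%VS.
Proof.
move=> /Phi_pow2 dI /Phi_pow2 eI; apply/(subvP (aug_pow_sub _ _ 2)).
exact: (@aug_powM _ _ _ _ 2 2).
Qed.

(** Membership in the Frattini part (Phi - 1) + I^3 of I^2. *)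
Local Notation frattini_mod := (grouplike_mod Phi (I ^+ 3)%VS).
Let frattiniD := grouplike_modD Phi_mul_pow3.
Let frattiniZ := grouplike_modZ Phi_mul_pow3.

Lemma frattini_mod_pow2 x : frattini_mod x -> x \in (I ^+ 2)%VS.
Proof.
move=> [d dPhi xd]; rewrite -(subrK (ge d - 1) x) rpredD ?Phi_pow2 //.
exact: (subvP (aug_pow_sub _ _ 1)).
Qed.

(** By bilinearity it is enough to take x = g - 1 and y = h - 1, for which the
    bracket is [g, h] - 1 modulo I^3. *)
Lemma bracket_frattini_mod x y : x \in I -> y \in I -> frattini_mod (x * y - y * x).
Proof.
move=> xI yI; apply: (aug_ideal_ind (P := fun x => frattini_mod (x * y - y * x))) xI.
- move=> u v uy vy; rewrite bracketDl; exact (frattiniD uy vy).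
- by move=> k u uy; rewrite -scalerAl -scalerAr -scalerBr; apply: frattiniZ.
move=> g; apply: (aug_ideal_ind (P := fun y =>
  frattini_mod ((ge g - 1) * y - y * (ge g - 1)))) yI.
- move=> u v uy vy; rewrite bracketDr; exact (frattiniD uy vy).
- by move=> k u uy; rewrite -scalerAl -scalerAr -scalerBr; apply: frattiniZ.
move=> h; exists [~ g, h]%g; first exact: commg_Phi.
rewrite (phi_comm (gelt1 _ _) (@geltM _ _)) -opprB rpredN.
rewrite -{2}[_ - _ * _]mul1r -mulrBl; apply: (@aug_powS _ _ _ _ 2).
  exact: gelt_sub1_aug.
by apply: bracket_pow2; apply: gelt_sub1_aug.
Qed.

(** For p > 2 the power lies in I^3.  For p = 2 squaring is additive up to
    brackets, and (g - 1)^2 = g^2 - 1. *)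
Lemma exp_frattini_mod x : x \in I -> frattini_mod (x ^+ p).
Proof.
move=> xI; case: (ltngtP p 2) => [p_lt2|p_gt2|p2].
- by have := prime_gt1 p_prime; rewrite ltnNge -ltnS p_lt2.
- by apply: grouplike_mod_ideal; apply: aug_exp.
suff [] : x \in I /\ frattini_mod (x ^+ p) by [].
apply: (aug_ideal_ind (P := fun x => x \in I /\ frattini_mod (x ^+ p))) xI.
- move=> u v [uI uF] [vI vF]; split; first exact: rpredD.
  have -> : (u + v) ^+ p = (u ^+ p + v ^+ p) + (u * v - v * u).
    have sq (w : A) : w ^+ p = w * w by rewrite -expr2 -p2.
    have vu : - (v * u) = v * u.
      by apply/eqP; rewrite eq_sym -addr_eq0 -mulr2n -p2 mulrn_pchar ?pchar_galg.
    by rewrite !sq vu mulrDl !mulrDr [RHS]addrACA [v * v + _]addrC.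
  exact (frattiniD (frattiniD uF vF) (bracket_frattini_mod uI vI)).
- by move=> k u [uI uF]; rewrite exprZn; split; [apply: rpredZ|apply: frattiniZ].
move=> g; split; first exact: gelt_sub1_aug.
rewrite -(phi_exp (gelt1 _ _) (@geltM _ _)); exists (g ^+ p)%g.
  exact: expg_Phi.
by rewrite subrr rpred0.
Qed.

(** The Frattini part receives the Frattini subgroup of every p-group mapping to
    1 + I, by the formulas for commutators and p-th powers.  So an isomorphism of
    group algebras maps one Frattini part into the other. *)
Lemma Phi_frattini_mod (kT : finGroupType) (phi : kT -> A) :
    (p.-group [set: kT])%g ->
    phi 1%g = 1 -> {morph phi : x y / (x * y)%g >-> x * y} ->
    (forall x, phi x - 1 \in I) ->
  forall d, d \in 'Phi([set: kT])%g -> frattini_mod (phi d - 1).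
Proof.
move=> K_pgroup phi1 phiM phi_aug d.
apply: (Phi_ind K_pgroup (P := fun d => frattini_mod (phi d - 1))).
- by rewrite phi1 subrr; apply: grouplike_mod_ideal; apply: rpred0.
- move=> x y xF yF; rewrite phiM mul_sub1.
  have xy : frattini_mod ((phi x - 1) * (phi y - 1)).
    by apply/grouplike_mod_ideal/aug_powS => //; apply: frattini_mod_pow2.
  exact (frattiniD (frattiniD xy xF) yF).
- move=> x y; rewrite (phi_comm phi1 phiM) -(subrK 1 (phi (x^-1 * y^-1)%g)).
  rewrite mulrDl mul1r addrC.
  have bI := bracket_pow2 (phi_aug x) (phi_aug y).
  have cbI := @aug_powS _ _ _ _ 2 (phi_aug (x^-1 * y^-1)%g) bI.
  exact (frattiniD (bracket_frattini_mod (phi_aug x) (phi_aug y))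
    (grouplike_mod_ideal Phi cbI)).
- by move=> x; rewrite phi_exp //; apply: exp_frattini_mod.
Qed.

End FrattiniPart.

(** * Recovering the group over F_p *)

(** As (g - 1)(h - 1) is in I^2, each element of I is congruent to some g - 1. *)
Lemma aug_repr_mod_pow2 (p : nat) (gT : finGroupType) (u : galg 'F_p gT) :
  u - 1 \in aug_ideal 'F_p gT ->
  exists g, u - gelt 'F_p g \in (aug_ideal 'F_p gT ^+ 2)%VS.
Proof.
move=> uI; have SG (d e : gT) : d \in [set: gT]%G -> e \in [set: gT]%G ->
    (gelt 'F_p d - 1) * (gelt 'F_p e - 1) \in (aug_ideal 'F_p gT ^+ 2)%VS.
  by move=> _ _; apply: (@aug_powS _ _ _ _ 1); rewrite ?expv1 gelt_sub1_aug.
have [g _ ug] : grouplike_mod [set: gT]%G (aug_ideal 'F_p gT ^+ 2)%VS (u - 1).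
  apply: (aug_ideal_ind (P := grouplike_mod [set: gT]%G _)) uI.
  - exact: grouplike_modD SG.
  - exact: grouplike_modZ SG.
  by move=> g; exists g; rewrite ?finset.in_setT // subrr rpred0.
by exists g; move: ug; rewrite opprB addrA subrK.
Qed.

Section DimensionSubgroup.

Variables (p : nat) (p_prime : prime p) (gT hT : finGroupType).
Hypothesis G_pgroup : (p.-group [set: gT])%g.
Hypothesis H_pgroup : (p.-group [set: hT])%g.
Local Notation A := (galg 'F_p gT).
Local Notation B := (galg 'F_p hT).
Local Notation I := (aug_ideal 'F_p gT).
Local Notation J := (aug_ideal 'F_p hT).
Local Notation ge := (gelt 'F_p).

Definition frattini_space : {vspace A} :=
  grouplike_space 'Phi([set: gT])%G (I ^+ 3)%VS.

(** A complement of the Frattini part in I^2, modulo I^3. *)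
Definition coset_space : {vspace A} := ((I ^+ 2) :\: frattini_space + I ^+ 3)%VS.
Local Notation Y := coset_space.

Let PhiM := @Phi_mul_pow3 _ p_prime _ G_pgroup.

Lemma coset_spaceS : (Y <= I ^+ 2)%VS.
Proof. by rewrite subv_add diffvSl (aug_pow_sub _ _ 1). Qed.

Lemma coset_space_pow3 x : x \in (I ^+ 3)%VS -> x \in Y.
Proof. exact/subvP/addvSr. Qed.

Lemma coset_space_frattini x : x \in Y -> x \in frattini_space -> x \in (I ^+ 3)%VS.
Proof.
move=> /memv_addP[y yD [z zI ->]] xF.
have I3F : (I ^+ 3 <= frattini_space)%VS by apply: addvSr.
suff -> : y = 0 by rewrite add0r.
apply/eqP; rewrite -memv0 -(capv_diff (I ^+ 2)%VS frattini_space) memv_cap yD.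
by rewrite -(addrK z y) rpredB // (subvP I3F).
Qed.

Lemma pow2_repr_mod_coset_space x : x \in (I ^+ 2)%VS ->
  exists2 d, d \in 'Phi([set: gT])%g & x - (ge d - 1) \in Y.
Proof.
rewrite -(addv_diff_cap (I ^+ 2)%VS frattini_space) => /memv_addP[y yD [z]].
rewrite memv_cap => /andP[_ /(grouplike_spaceP PhiM)[d dPhi zd]] ->.
by exists d => //; rewrite -addrA; apply: memv_add.
Qed.

(** Since I Y and Y I lie in I^3, congruence modulo Y is compatible with
    multiplication by elements of 1 + I. *)
Lemma coset_space_mull u x : u - 1 \in I -> x \in Y -> u * x \in Y.
Proof.
move=> uI xY; rewrite -(subrK 1 u) mulrDl mul1r rpredD //.
by apply/coset_space_pow3/(@aug_powS _ _ _ _ 2) => //; apply: (subvP coset_spaceS).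
Qed.

Lemma coset_space_mulr u x : u - 1 \in I -> x \in Y -> x * u \in Y.
Proof.
move=> uI xY; rewrite -(subrK 1 u) mulrDr mulr1 rpredD //.
apply/coset_space_pow3/(@aug_powM _ _ _ _ 2 1); last by rewrite expv1.
exact: (subvP coset_spaceS).
Qed.

(** Correct a representative modulo I^2 by an element of Phi(G). *)
Lemma coset_repr u : u - 1 \in I -> exists g, u - ge g \in Y.
Proof.
move=> /aug_repr_mod_pow2[g ug].
have [d dPhi ugd] := pow2_repr_mod_coset_space (@aug_pow_mulr _ _ (ge g^-1%g) _ 1 ug).
exists (d * g)%g; have := coset_space_mulr (gelt_sub1_aug _ g) ugd.
rewrite !mulrBl mul1r -!mulrA -geltM mulVg gelt1 !mulr1 geltM.
by rewrite opprB addrA subrK.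
Qed.

Hypothesis G_D3 : dimension_subgroup 'F_p gT 3 = 1%g.

(** If d = g g'^-1 satisfies d - 1 in Y, then d is in Phi(G) because Y is in I^2,
    so d - 1 is in I^3 because Y meets the Frattini part in I^3. *)
Lemma coset_repr_uniq u g g' : u - ge g \in Y -> u - ge g' \in Y -> g = g'.
Proof.
move=> ug ug'; have gg' : ge g - ge g' \in Y.
  by rewrite -(subrK u (ge g)) -addrA rpredD // -opprB rpredN.
have := coset_space_mulr (gelt_sub1_aug _ g'^-1%g) gg'.
rewrite mulrBl -!geltM mulgV gelt1 => dY.
have dPhi := D2_Phi p_prime G_pgroup (subvP coset_spaceS _ dY).
have dI : (g * g'^-1)%g \in dimension_subgroup 'F_p gT 3.
  rewrite finset.in_set; apply: coset_space_frattini dY _.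
  apply/(grouplike_spaceP PhiM); exists (g * g'^-1)%g => //.
  by rewrite subrr rpred0.
move: dI; rewrite G_D3 => /set1P/(canRL (mulgKV _)).
by rewrite mul1g.
Qed.

(** Transport H into 1 + I by f^-1, and round modulo Y to elements of G.  For
    surjectivity, given g, correct f(g) first by some h0 in H modulo J^2; the
    error f(g) h0^-1 - 1 in J^2 is, up to f(Y), of the form f(d) - 1 with d in
    Phi(G), and this is h - 1 modulo J^3 for some h in H.  So f(g) and h h0 agree
    modulo f(Y). *)
Lemma D3_isog (f : {lrmorphism A -> B}) :
  bijective f -> ([set: gT] \isog [set: hT])%g.
Proof.
move=> [f' fK f'K].
pose fL := GRing.isLinear.Build 'F_p _ _ _ f' (can2_linear fK f'K).
pose fR := GRing.isMonoidMorphism.Build _ _ f' (can2_monoid_morphism fK f'K).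
pose f1 : {lrmorphism B -> A} := HB.pack f' fL fR.
have f1_pow n x : x \in (J ^+ n.+1)%VS -> f1 x \in (I ^+ n.+1)%VS.
  exact: lrmorphism_pow.
have f1_sub1 h : f1 (ge h) - 1 \in I.
  have -> : f1 (ge h) - 1 = f1 (ge h - 1) by rewrite linearB rmorph1.
  by have := f1_pow 0%N (ge h - 1); rewrite !expv1; apply; apply: gelt_sub1_aug.
have f_sub1 g : f (ge g) - 1 \in J.
  have -> : f (ge g) - 1 = f (ge g - 1) by rewrite linearB rmorph1.
  have := @lrmorphism_pow _ p_prime _ _ G_pgroup f 0%N (ge g - 1).
  by rewrite !expv1; apply; apply: gelt_sub1_aug.
have /choice[rho rhoP] h := coset_repr (f1_sub1 h).
have rhoM : {in [set: hT]%g &, {morph rho : x y / (x * y)%g}}.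
  move=> x y _ _; apply: (coset_repr_uniq (rhoP _)); rewrite geltM rmorphM geltM.
  rewrite -(subrK (f1 (ge x) * ge (rho y)) (_ * _)) -mulrBr -addrA -mulrBl.
  have xy := coset_space_mull (f1_sub1 x) (rhoP y).
  exact (rpredD xy (coset_space_mulr (gelt_sub1_aug _ (rho y)) (rhoP x))).
have rho_surj g : exists h, rho h = g.
  have [h0 gh0] := aug_repr_mod_pow2 (f_sub1 g).
  have [d dPhi wd] := pow2_repr_mod_coset_space
    (f1_pow 1%N _ (aug_pow_mulr (ge h0^-1%g) gh0)).
  have phi1 : f (ge 1%g) = 1 by rewrite gelt1 rmorph1.
  have phiM : {morph (fun x => f (ge x)) : x y / (x * y)%g >-> x * y}.
    by move=> x y; rewrite geltM rmorphM.
  have [h _ dh] := Phi_frattini_mod p_prime H_pgroup G_pgroup phi1 phiM f_sub1 dPhi.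
  exists (h * h0)%g; apply/esym/(coset_repr_uniq _ (rhoP _)).
  have dhY := coset_space_pow3 (f1_pow 2%N _ dh).
  have := coset_space_mulr (f1_sub1 h0) (rpredD wd dhY).
  have f1d : f1 (f (ge d) - 1 - (ge h - 1)) = ge d - 1 - (f1 (ge h) - 1).
    by rewrite !rmorphB rmorph1; congr (_ - 1 - _); apply: fK.
  have f1g : f1 ((f (ge g) - ge h0) * ge h0^-1%g) = ge g * f1 (ge h0^-1%g) - 1.
    rewrite mulrBl -geltM mulgV gelt1 linearB rmorphM rmorph1.
    by congr (_ * _ - 1); apply: fK.
  rewrite [f1 (_ - _)]f1d f1g addrA subrK opprB addrA subrK mulrBl -mulrA.
  rewrite -!rmorphM -!geltM mulVg gelt1 rmorph1 mulr1 => gh.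
  by rewrite -opprB rpredN.
have cardGH : #|gT| = #|hT|.
  apply/eqP; rewrite eqn_leq; apply/andP; split.
    apply: (@mulmx1_min 'F_p _ _ (gmatrix f) (gmatrix f1)).
    apply/row_matrixP => i; rewrite !rowE mulmx1 -[delta_mx 0 i]gvectK mulmxA.
    by rewrite -!gmatrixE /= fK.
  apply: (@mulmx1_min 'F_p _ _ (gmatrix f1) (gmatrix f)).
  apply/row_matrixP => i; rewrite !rowE mulmx1 -[delta_mx 0 i]gvectK mulmxA.
  by rewrite -!gmatrixE /= f'K.
pose r := Morphism rhoM.
have r_im : (r @* [set: hT])%g = [set: gT]%g.
  apply/setP => g; rewrite finset.in_setT; have [h <-] := rho_surj g.
  by apply: mem_morphim; rewrite finset.in_setT.
rewrite isog_sym; apply/isogP; exists r => //.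
by rewrite -card_im_injm r_im !cardsT cardGH.
Qed.

End DimensionSubgroup.

Theorem theorem4 (p : nat) (p_prime : prime p)
    (gT : finGroupType) (G_pgroup : (p.-group [set: gT])%g)
    (G_D3 : dimension_subgroup 'F_p gT 3 = 1%g)
    (K : closedFieldType) (iota : {rmorphism 'F_p -> K})
    (K_algebraic : integralRange iota)
    (m : nat) (m_gt0 : (0 < m)%N)
    (m_coprime : coprime m (num_aut_components K gT)`!)
    (F : finFieldType) (F_card : #|F| = (p ^ m)%N)
    (hT : finGroupType) (H_pgroup : (p.-group [set: hT])%g) :
  (exists f : {lrmorphism galg F gT -> galg F hT}, bijective f) ->
  ([set: gT] \isog [set: hT])%g.
Proof.
move/(group_algebra_descent p_prime K_algebraic m_gt0 m_coprime F_card).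
by case=> f; apply: D3_isog.
Qed.
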